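(* Let $0<p\le 1$ and let $X$ be a Banach space. Then $\mathring{H}_p^{\delta,m}(I,X)=H_p^{\delta,a}(I,X)$.
   Context: $I=[-1/2,1/2)$. $\mathcal{D}$ is the set of all dyadic intervals contained in $I$ (obtained from $I$ by repeated halving into left-closed right-open intervals, including $I$), $\mathcal{D}_n=\{J\in\mathcal{D}:|J|=2^{-n}\}$, and $\Delta_n$ is the finite $\sigma$-algebra generated by $\mathcal{D}_n$, $n\in\mathbb{N}_0$. $\mathcal{M}(I,X)$ is the vector space of $X$-valued dyadic martingales: sequences $F=(f_n)_{n=0}^\infty$ of functions $f_n\colon I\to X$ that are $\Delta_n$-measurable with $\mathbb{E}(f_{n+1},\Delta_n)=f_n$ for all $n$. The maximal function of $F$ is $F^*=\sup_n\|f_n\|_X$. $H_p^{\delta,m}(I,X)$ is the quasi-Banach space of all $F\in\mathcal{M}(I,X)$ with $\|F\|_{H_p^{\delta,m}(I,X)}=\|F^*\|_{L_p(I)}<\infty$. $L_1(I,X)$ is regarded as a subspace of $\mathcal{M}(I,X)$ via the martingale transform $\delta(f)=(\mathbb{E}(f,\Delta_n))_{n=0}^\infty$, and $\mathring{H}_p^{\delta,m}(I,X)$ is the closure of $H_p^{\delta,m}(I,X)\cap L_1(I,X)$ in $H_p^{\delta,m}(I,X)$. If $F=(f_n)_{n=0}^\infty\in\mathring{H}_p^{\delta,m}(I,X)$, then $(f_n)_{n=0}^\infty$ converges in $L_p(I,X)$, and $F\mapsto\lim_nf_n$ is a bounded linear map from $\mathring{H}_p^{\delta,m}(I,X)$ into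 $L_p(I,X)$; martingales are identified with their limit functions. An $X$-valued dyadic $p$-atom associated with $J\in\mathcal{D}$ is a strongly measurable $a\colon I\to X$ with $\operatorname{supp}(a)\subseteq J$, $\|a\|_{L_\infty(I,X)}\le|J|^{-1/p}$ and $\int_Ia=0$. $\mathcal{A}_p^\delta(I,X)$ is the set of all functions $a\colon I\to X$ that are either dyadic $p$-atoms or constant functions whose value lies in the unit ball of $X$; it is contained in the unit ball of $L_p(I,X)$, so $\sum_{j\in\mathcal{J}}\lambda_ja_j$ converges in $L_p(I,X)$ whenever $\mathcal{J}$ is countable, $a_j\in\mathcal{A}_p^\delta(I,X)$ and $(\lambda_j)_{j\in\mathcal{J}}\in\ell_p(\mathcal{J})$. $H_p^{\delta,a}(I,X)$ is the quasi-Banach space of all functions $f\in L_p(I,X)$ that can be expanded as $f=\sum_{j\in\mathcal{J}}\lambda_ja_j$ in this way, endowed with the $p$-norm $f\mapsto\inf\big(\sum_{j\in\mathcal{J}}|\lambda_j|^p\big)^{1/p}$, the infimum being over all such expansions of $f$. *)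

(* Defs.v *)
From HB Require Import structures.
From mathcomp Require Import all_boot all_order all_algebra.
From mathcomp Require Import all_classical all_reals all_analysis.

Set Implicit Arguments.
Unset Strict Implicit.
Unset Printing Implicit Defensive.

Import Order.TTheory GRing.Theory Num.Theory.
Import numFieldNormedType.Exports.

Local Open Scope classical_set_scope.
Local Open Scope ring_scope.

(* A function I -> X is represented by a function R -> X whose values outside
   I are irrelevant: every notion below only depends on the restriction to I. *)

Section Dyadic.
Context {R : realType}.

Definition unitI : set R := `[- 2^-1, 2^-1[.

Definition dyadic_itv (n k : nat) : set R :=
  `[- 2^-1 + k%:R * 2 ^- n, - 2^-1 + k.+1%:R * 2 ^- n[.

Definition dyadics (n : nat) : set (set R) := dyadic_itv n @` `I_(2 ^ n).

Definition Delta (n : nat) : set (set R) := <<s unitI, dyadics n >>.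

End Dyadic.

Section BochnerIntegral.
Context {R : realType} {X : completeNormedModType R}.
Implicit Types (f g s : R -> X) (A : set R) (v : X).

Definition simple_fun s : Prop :=
  finite_set (range s) /\
  forall y, @measurable _ (measurableTypeR R) (s @^-1` [set y]).

Definition strongly_measurable f : Prop :=
  exists s_ : nat -> R -> X, (forall n, simple_fun (s_ n)) /\
    forall x, unitI x -> s_ n x @[n --> \oo] --> f x.

Definition simple_integral A s : X :=
  \sum_(y \in range s) fine (lebesgue_measure (A `&` s @^-1` [set y])) *: y.

(* f is Bochner integrable on A, with integral v; used for A `<=` unitI. *)
Definition is_bochner_integral A f v : Prop :=
  strongly_measurable f /\
  exists s_ : nat -> R -> X,
    [/\ forall n, simple_fun (s_ n),
        (\int[lebesgue_measure]_(x in A) (`|f x - s_ n x|)%:E)%E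
          @[n --> \oo] --> 0%E
      & simple_integral A (s_ n) @[n --> \oo] --> v].

Definition Lp_norm (p : \bar R) f : \bar R :=
  'N[lebesgue_measure]_p[(fun x => (`|f x|)%:E) \_ unitI]%E.

Definition Lp (p : \bar R) : set (R -> X) :=
  [set f | strongly_measurable f /\ (Lp_norm p f < +oo)%E].

Definition Lp_cvg (p : \bar R) (f_ : nat -> R -> X) f : Prop :=
  Lp_norm p (fun x => f_ n x - f x) @[n --> \oo] --> 0%E.

Definition Delta_measurable (n : nat) f : Prop :=
  forall U : set X, open U -> Delta n (unitI `&` f @^-1` U).

(* g = E(f, Delta_n). *)
Definition is_cond_exp (n : nat) f g : Prop :=
  Delta_measurable n g /\
  forall A, Delta n A ->
    exists v, is_bochner_integral A f v /\ is_bochner_integral A g v.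

End BochnerIntegral.

Section MartingaleHardySpace.
Context {R : realType} {X : completeNormedModType R}.
Implicit Types (p : R) (F G : nat -> R -> X) (f : R -> X).

Definition dyadic_martingale : set (nat -> R -> X) :=
  [set F | forall n, Delta_measurable n (F n) /\ is_cond_exp n (F n.+1) (F n)].

Definition maximal_fun F (x : R) : \bar R :=
  ereal_sup (range (fun n => (`|F n x|)%:E)).

Definition Hm_norm p F : \bar R :=
  'N[lebesgue_measure]_p%:E[maximal_fun F \_ unitI]%E.

Definition Hm p : set (nat -> R -> X) :=
  [set F | dyadic_martingale F /\ (Hm_norm p F < +oo)%E].

(* The image of L_1 under delta. *)
Definition L1_martingale : set (nat -> R -> X) :=
  [set F | exists2 f, Lp 1%E f & forall n, is_cond_exp n f (F n)].

Definition Hm_ring p : set (nat -> R -> X) :=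
  [set F | Hm p F /\
     forall e : R, 0 < e -> exists G, [/\ Hm p G, L1_martingale G
       & (Hm_norm p (fun n x => (F n x - G n x)%R) < e%:E)%E]].

(* Hm_ring as a space of functions, each martingale being identified with its
   limit in L_p, i.e. the image of Hm_ring under F |-> lim_n F n.  For p < 1
   this map is not injective: the martingale whose n-th term is 2 ^+ n times the
   indicator of the interval of dyadics n containing 0 belongs to Hm_ring p and
   has limit 0.  Hence the infimum in the induced quasi-norm. *)
Definition Hm_ring_fun p : set (R -> X) :=
  [set f | Lp p%:E f /\ exists2 F, Hm_ring p F & Lp_cvg p%:E F f].

Definition Hm_ring_fun_norm p f : \bar R :=
  ereal_inf [set Hm_norm p F | F in [set F | Hm_ring p F /\ Lp_cvg p%:E F f]].

End MartingaleHardySpace.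

Section AtomicHardySpace.
Context {R : realType} {X : completeNormedModType R}.
Implicit Types (p : R) (a f : R -> X) (lambda : nat -> R).

Definition dyadic_atom p a : Prop :=
  exists n (J : set R), dyadics n J /\
    [/\ strongly_measurable a,
        forall x, unitI x -> ~ J x -> a x = 0,
        (Lp_norm +oo%E a <= ((2 ^- n) `^ (- p^-1))%:E)%E
      & is_bochner_integral unitI a 0].

Definition atoms p : set (R -> X) :=
  [set a | dyadic_atom p a \/
     exists2 v : X, `|v| <= 1 & forall x, unitI x -> a x = v].

(* The countable index set is nat; finite expansions are padded with zero
   coefficients. *)
Definition atomic_expansion p f lambda (a_ : nat -> R -> X) : Prop :=
  [/\ forall j, atoms p (a_ j),
      (\sum_(0 <= j <oo) (`|lambda j| `^ p)%:E < +oo)%E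
    & Lp_cvg p%:E (fun n x => \sum_(j < n) lambda j *: a_ j x) f].

Definition Ha p : set (R -> X) :=
  [set f | Lp p%:E f /\ exists lambda (a_ : nat -> R -> X),
    atomic_expansion p f lambda a_].

Definition Ha_norm p f : \bar R :=
  ereal_inf [set ((\sum_(0 <= j <oo) (`|la.1 j| `^ p)%:E) `^ p^-1)%E
            | la in [set la : (nat -> R) * (nat -> R -> X)
                    | atomic_expansion p f la.1 la.2]].

End AtomicHardySpace.

(* Main.v *)
(* If f is the sum of lambda_j a_j with atoms a_j, then the
   martingales delta(a_j) have maximal p-mass at most 1, each being dominated by
   |J|^(-1/p) on the interval J of the atom and vanishing elsewhere; since t^p is
   subadditive, the sum of lambda_j delta(a_j) converges in Hm, and it converges
   to f because E(a_j, Delta_n) tends to a_j almost everywhere by Lebesgue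
   differentiation.
   Conversely, a martingale of the closure is a limit of martingales stopped at
   a finite level, so by telescoping it is enough to decompose finite trees of
   averages with control of the p-mass.  This is done by induction on the depth
   of the tree, with a running threshold t that bounds the current average: if
   some child average exceeds t, then t is replaced by some u >= 2 t and an atom
   of height 2 u is emitted on the parent interval.  As the thresholds at least
   double, the masses of the emitted atoms add up to a multiple of the p-mass of
   the maximal function. *)
Require Import Defs.
From mathcomp Require Import all_boot all_order all_algebra.
From mathcomp Require Import all_classical all_reals all_analysis.
From mathcomp Require Import measurable_realfun ess_sup_inf.
From mathcomp Require Import lebesgue_integral_differentiation ring lra.

Set Implicit Arguments.
Unset Strict Implicit.
Unset Printing Implicit Defensive.

Import Order.TTheory GRing.Theory Num.Theory.
Import numFieldNormedType.Exports.
(* Re-imported to hide the [dyadic_itv] of the library. *)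
Import Defs.

Local Open Scope classical_set_scope.
Local Open Scope ring_scope.

(** * Simple functions and the Bochner integral *)

Section SimpleMaps.
Context {R : realType}.
Local Notation mu := (@lebesgue_measure R).
Local Notation TR := (measurableTypeR R).
Implicit Types A B : set R.

(** In the converse direction the obstacle is that a child average can exceed that of its parent by
    an arbitrary factor, so the piece cut off where a level is first passed is not bounded by that
    level. The remainder is therefore charged to the parent interval J, at a height governed by a
    threshold u that dominates both children. This is affordable because each child has half the
    measure of J: raising t to u changes the p-mass by |J| (u^p - t^p), the child that forces the
    jump accounts for half of this, and u >= 2 t makes u^p - t^p comparable to u^p. The induction
    needs no measure theory, since [dyadic_martingaleP] codes a martingale by the tree of its values
    c n k on the intervals. As p <= 1, estimates are made with the p-th powers [lp] and [hp] of the
    quasi-norms, which are subadditive. In the other direction the martingale given by [synthesis]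
    depends on the expansion and not on f alone: for p < 1 distinct martingales may share a limit.
    What is proved is thus an equality of sets of functions, with equivalent quasi-norms. *)

Definition simple_map (T : Type) (s : R -> T) : Prop :=
  finite_set (range s) /\ forall y, @measurable _ TR (s @^-1` [set y]).

Lemma simple_map_preimage (T : Type) (s : R -> T) (B : set T) :
  simple_map s -> @measurable _ TR (s @^-1` B).
Proof.
move=> [fs ms].
have -> : s @^-1` B = \bigcup_(y in range s `&` B) s @^-1` [set y].
  apply/seteqP; split => x /=; last by move=> [y [_ By]] /= ->.
  by move=> Bx; exists (s x) => //; split=> //; exists x.
by apply: fin_bigcup_measurable => //; exact: finite_setIl.
Qed.

Lemma simple_map_comp (T U : Type) (h : T -> U) (s : R -> T) :
  simple_map s -> simple_map (fun x => h (s x)).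
Proof.
move=> ss; split=> [|y]; last first.
  by rewrite -[X in measurable X]/(s @^-1` (h @^-1` [set y]));
    exact: simple_map_preimage.
rewrite (_ : [set h (s x) | x in setT] = h @` range s).
  exact/finite_image/ss.1.
by rewrite image_comp.
Qed.

(** Two simple functions share a finite partition, that of their pair, on which linearity of the
    integral is computed. Pairs, booleans and dyadic indices are the reason why [simple_map] leaves
    the codomain free. *)
Lemma simple_map_pair (T U : Type) (s : R -> T) (t : R -> U) :
  simple_map s -> simple_map t -> simple_map (fun x => (s x, t x)).
Proof.
move=> ss st; split=> [|[a b]].
  apply: (@sub_finite_set _ _ (range s `*` range t)).
    by move=> _ [x _ <-]; split; exists x.
  exact: finite_setX ss.1 st.1.
rewrite (_ : _ @^-1` _ = s @^-1` [set a] `&` t @^-1` [set b]).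
  by apply: measurableI; [exact: ss.2|exact: st.2].
by apply/seteqP; split=> x /= [-> ->].
Qed.

Lemma simple_map_mem A : @measurable _ TR A -> simple_map (fun x => x \in A).
Proof.
move=> mA; split=> [|b]; first exact: finite_finset.
rewrite (_ : _ @^-1` _ = if b then A else ~` A).
  by case: b => //; exact: measurableC.
apply/seteqP; split=> x /=; case: b => //.
- exact: set_mem.
- by move=> xA Ax; rewrite mem_set in xA.
- exact: mem_set.
- by move=> Ax; apply/negbTE; rewrite notin_setE.
Qed.

Lemma measurable_unitI : @measurable _ TR unitI.
Proof. exact: measurable_itv. Qed.

Lemma mu_unitI : mu unitI = 1%E.
Proof.
rewrite /unitI lebesgue_measure_itv/= lte_fin ifT; last lra.
by rewrite -EFinB; congr (_%:E); lra.
Qed.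

Lemma mu_sub_fin A : @measurable _ TR A -> A `<=` unitI -> mu A \is a fin_num.
Proof.
move=> mA AI; rewrite ge0_fin_numE//.
apply: (@le_lt_trans _ _ (mu unitI)); last by rewrite mu_unitI ltry.
by apply: le_measure => //; rewrite inE//; exact: measurable_unitI.
Qed.

Lemma fine_mu_sum (T : choiceType) (s : R -> T) (ts : seq T) A :
  simple_map s -> uniq ts -> range s `<=` [set` ts] ->
  @measurable _ TR A -> A `<=` unitI ->
  fine (mu A) = \sum_(t <- ts) fine (mu (A `&` s @^-1` [set t])).
Proof.
move=> ss uts sts mA AI.
have mAs t : @measurable _ TR (A `&` s @^-1` [set t]).
  by apply: measurableI => //; exact: ss.2.
rewrite sum_fine; last first.
  by move=> t _; apply: mu_sub_fin => // x [/AI].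
congr fine.
have AE : A = \bigcup_(t in [set` ts]) (A `&` s @^-1` [set t]).
  apply/seteqP; split=> x; last by move=> [t _ []].
  by move=> Ax; exists (s x) => //; apply: sts; exists x.
rewrite [in LHS]AE measure_fin_bigcup//; first by rewrite -fsbig_seq.
by move=> i j _ _ [x [[_ <-] [_ <-]]].
Qed.

End SimpleMaps.

Section SimpleIntegral.
Context {R : realType} {X : completeNormedModType R}.
Local Notation mu := (@lebesgue_measure R).
Local Notation TR := (measurableTypeR R).
Implicit Types (A B : set R) (s t : R -> X).

Lemma simple_integralE A s (ys : seq X) : uniq ys -> range s `<=` [set` ys] ->
  simple_integral A s =
  \sum_(y <- ys) fine (mu (A `&` s @^-1` [set y])) *: y.
Proof.
move=> uys sys; rewrite /simple_integral [RHS]fsbig_seq//; apply: fsbig_widen => //.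
move=> y [_ ny] /=.
rewrite (_ : _ `&` _ = set0) ?measure0 ?scale0r//.
by apply/seteqP; split=> x // [_ /= sxy]; apply: ny; exists x.
Qed.

(** A double count over pairs (t, y): the set where r x = t and h (r x) = y is empty unless y = h t.
    So the partition given by r may be used even when h identifies some of its values. *)
Lemma simple_integral_comp (T : choiceType) (r : R -> T) (h : T -> X) A
    (ts : seq T) : simple_map r -> uniq ts -> range r `<=` [set` ts] ->
  @measurable _ TR A -> A `<=` unitI ->
  simple_integral A (fun x => h (r x)) =
  \sum_(t <- ts) fine (mu (A `&` r @^-1` [set t])) *: h t.
Proof.
move=> sr uts rts mA AI.
set ys := undup (map h ts).
have hys : range (fun x => h (r x)) `<=` [set` ys].
  move=> _ [x _ <-] /=; rewrite mem_undup; apply: map_f.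
  by apply: rts; exists x.
rewrite (simple_integralE _ (undup_uniq _) hys).
have shr := simple_map_comp h sr.
have mI B (T' : Type) (q : R -> T') y : simple_map q -> @measurable _ TR B ->
    @measurable _ TR (B `&` q @^-1` [set y]).
  by move=> sq mB; apply: measurableI => //; exact: sq.2.
under eq_bigr => y _.
  rewrite (fine_mu_sum sr uts rts); [|exact: mI|by move=> x [/AI]].
  rewrite scaler_suml; over.
rewrite exchange_big/=; apply: eq_bigr => t _.
rewrite (fine_mu_sum shr (undup_uniq _) hys); [|exact: mI|by move=> x [/AI]].
rewrite scaler_suml; apply: eq_bigr => y _.
rewrite -setIA [X in _ `&` X]setIC setIA.
have [->//|yt] := eqVneq y (h t).
rewrite (_ : _ `&` _ `&` _ = set0) ?measure0 ?scale0r//.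
apply/seteqP; split=> x // [[_ /= rx] /= hx].
by move: yt; rewrite -hx rx eqxx.
Qed.

Lemma simple_integral_lin A a s t : simple_fun s -> simple_fun t ->
  @measurable _ TR A -> A `<=` unitI ->
  simple_integral A (fun x => a *: s x + t x) =
  a *: simple_integral A s + simple_integral A t.
Proof.
move=> ss st mA AI; have sst := simple_map_pair ss st.
have /finite_seqP[ts0 tsE] := sst.1.
set ts := undup ts0.
have rts : range (fun x => (s x, t x)) `<=` [set` ts].
  by rewrite tsE => z /=; rewrite mem_undup.
have uts := undup_uniq ts0.
rewrite (simple_integral_comp (fun z : X * X => a *: z.1 + z.2) sst uts rts)//.
rewrite (simple_integral_comp (fun z : X * X => z.1) sst uts rts)//.
rewrite (simple_integral_comp (fun z : X * X => z.2) sst uts rts)//.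
rewrite scaler_sumr -big_split/=; apply: eq_bigr => z _.
by rewrite scalerDr !scalerA mulrC.
Qed.

Lemma measurable_simple_norm s : simple_fun s ->
  measurable_fun setT (fun x : TR => `|s x|).
Proof.
by move=> ss _ B mB; rewrite setTI; exact: (simple_map_preimage ((fun v : X => `|v|) @^-1` B)).
Qed.

Lemma integral_simple_norm A s (ys : seq X) : simple_fun s ->
  uniq ys -> range s `<=` [set` ys] ->
  @measurable _ TR A -> A `<=` unitI ->
  (\int[mu]_(x in A) (`|s x|)%:E)%E =
  (\sum_(y <- ys) fine (mu (A `&` s @^-1` [set y])) * `|y|)%:E.
Proof.
move=> ss uys sys mA AI.
have mAy y : @measurable _ TR (A `&` s @^-1` [set y]).
  by apply: measurableI => //; exact: ss.2.
have AE : A = \big[setU/set0]_(y <- ys) (A `&` s @^-1` [set y]).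
  rewrite -bigcup_seq; apply/seteqP; split=> x; last by move=> [t _ []].
  by move=> Ax; exists (s x) => //; apply: sys; exists x.
rewrite [in LHS]AE ge0_integral_bigsetU//.
- rewrite -sumEFin; apply: eq_bigr => y _.
  rewrite (@eq_integral _ _ _ _ _ (cst (`|y|%:E))); last first.
    by move=> x /set_mem [_ /= ->].
  rewrite integral_cst// muleC EFinM fineK//.
  by apply: mu_sub_fin => // x [/AI].
- by move=> i j _ _ [x [[_ <-] [_ <-]]].
- by apply/measurable_EFinP; apply: measurable_funTS; exact: measurable_simple_norm.
Qed.

Lemma simple_integral_norm A s : simple_fun s ->
  @measurable _ TR A -> A `<=` unitI ->
  ((`|simple_integral A s|)%:E <= \int[mu]_(x in A) (`|s x|)%:E)%E.
Proof.
move=> ss mA AI; have /finite_seqP[ys0 ysE] := ss.1.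
have rys : range s `<=` [set` undup ys0].
  by rewrite ysE => z /=; rewrite mem_undup.
rewrite (integral_simple_norm ss (undup_uniq _) rys)//.
rewrite (simple_integralE _ (undup_uniq _) rys) lee_fin.
apply: le_trans (ler_norm_sum _ _ _) _; apply: ler_sum => y _.
by rewrite normrZ ger0_norm// fine_ge0.
Qed.

Lemma simple_integralU A B s : simple_fun s ->
  @measurable _ TR A -> A `<=` unitI -> @measurable _ TR B -> B `<=` unitI ->
  [disjoint A & B] ->
  simple_integral (A `|` B) s = simple_integral A s + simple_integral B s.
Proof.
move=> ss mA AI mB BI AB; have /finite_seqP[ys0 ysE] := ss.1.
have rys : range s `<=` [set` undup ys0].
  by rewrite ysE => z /=; rewrite mem_undup.
rewrite !(simple_integralE _ (undup_uniq _) rys) -big_split/=.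
apply: eq_bigr => y _; rewrite -scalerDl; congr (_ *: _).
have mI C : @measurable _ TR C -> @measurable _ TR (C `&` s @^-1` [set y]).
  by move=> mC; apply: measurableI => //; exact: ss.2.
have fI C : @measurable _ TR C -> C `<=` unitI ->
    mu (C `&` s @^-1` [set y]) \is a fin_num.
  by move=> mC CI; apply: mu_sub_fin; [exact: mI|move=> x [/CI]].
rewrite -fineD ?fI//; congr fine.
rewrite setIUl measureU//; [exact: mI|exact: mI|].
move/disj_setPS: AB => AB; apply/seteqP; split=> x // [[Ax _] [Bx _]].
by have := AB x (conj Ax Bx).
Qed.

Lemma simple_integral_cst A (v : X) : @measurable _ TR A -> A `<=` unitI ->
  simple_integral A (fun=> v) = fine (mu A) *: v.
Proof.
move=> mA AI; rewrite (@simple_integralE _ _ [:: v])//.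
  by rewrite big_seq1 (_ : _ @^-1` _ = setT) ?setIT//; apply/seteqP.
by move=> _ [x _ <-] /=; rewrite inE.
Qed.

End SimpleIntegral.

(** Convergence to 0 in the extended reals also asks the terms to be eventually finite; the case e =
    1 of the criterion supplies this. *)
Lemma cvge0P {R : realType} (u : nat -> \bar R) : (forall n, (0 <= u n)%E) ->
  u n @[n --> \oo] --> 0%E <->
  forall e : R, 0 < e -> \forall n \near \oo, (u n < e%:E)%E.
Proof.
move=> u0; split=> [/fine_cvgP[ufin /cvgr0Pnorm_lt uc] e e0|ulte].
  have := uc e e0; apply: filterS2 ufin => n un /=.
  by rewrite ger0_norm ?fine_ge0// -lte_fin fineK.
have uf : \forall n \near \oo, u n \is a fin_num.
  apply: filterS (ulte 1 ltr01) => n un1.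
  by rewrite ge0_fin_numE// (lt_trans un1)// ltry.
apply/fine_cvgP; split=> //; apply/cvgr0Pnorm_lt => e e0.
have := ulte e e0; apply: filterS2 uf => n un /=.
by rewrite ger0_norm ?fine_ge0// -lte_fin fineK.
Qed.

Section Bochner.
Context {R : realType} {X : completeNormedModType R}.
Local Notation mu := (@lebesgue_measure R).
Local Notation TR := (measurableTypeR R).
Implicit Types (A B : set R) (f g s t : R -> X) (v w : X).

Lemma strongly_measurable_norm f : strongly_measurable f ->
  measurable_fun unitI (fun x : TR => `|f x|).
Proof.
move=> [s_ [ss sf]]; apply: (@measurable_fun_cvg _ _ _ _ (fun n x => `|s_ n x|)).
  by move=> n; apply: measurable_funTS; exact: measurable_simple_norm.
by move=> x Ix; apply: cvg_norm; exact: sf.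
Qed.

Lemma simple_strongly_measurable s : simple_fun s -> strongly_measurable s.
Proof. by move=> ss; exists (fun=> s); split=> // x _; exact: cvg_cst. Qed.

Lemma simple_fun_lin a s t : simple_fun s -> simple_fun t ->
  simple_fun (fun x => a *: s x + t x).
Proof.
move=> ss st.
exact: (simple_map_comp (fun z : X * X => a *: z.1 + z.2) (simple_map_pair ss st)).
Qed.

Lemma simple_fun_cst v : simple_fun (fun _ : R => v).
Proof.
apply: (simple_map_comp (fun=> v) (s := fun x => x \in unitI)).
exact: simple_map_mem measurable_unitI.
Qed.

Lemma strongly_measurable_lin a f g : strongly_measurable f ->
  strongly_measurable g -> strongly_measurable (fun x => a *: f x + g x).
Proof.
move=> [s_ [ss sf]] [t_ [st tg]]; exists (fun n x => a *: s_ n x + t_ n x).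
split=> [n|x Ix]; first exact: simple_fun_lin.
by apply: cvgD; [apply: cvgZr; exact: sf|exact: tg].
Qed.

Lemma strongly_measurable_eq f g : {in unitI, f =1 g} ->
  strongly_measurable f -> strongly_measurable g.
Proof.
move=> fg [s_ [ss sf]]; exists s_; split=> // x Ix.
by rewrite -fg ?inE//; exact: sf.
Qed.

Lemma strongly_measurableB f g : strongly_measurable f ->
  strongly_measurable g -> strongly_measurable (fun x => f x - g x).
Proof.
move=> mf mg; apply: strongly_measurable_eq (strongly_measurable_lin (-1) mg mf).
by move=> x _; rewrite scaleN1r addrC.
Qed.

Lemma measurable_norm_sub A f : A `<=` unitI -> strongly_measurable f ->
  measurable_fun A (fun x : TR => (`|f x|)%:E).
Proof.
move=> AI mf; apply/measurable_EFinP.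
by apply: measurable_funS AI (strongly_measurable_norm mf); exact: measurable_unitI.
Qed.

Lemma integral_norm_triangle A f g : @measurable _ TR A -> A `<=` unitI ->
  strongly_measurable f -> strongly_measurable g ->
  (\int[mu]_(x in A) (`|f x + g x|)%:E <=
   \int[mu]_(x in A) (`|f x|)%:E + \int[mu]_(x in A) (`|g x|)%:E)%E.
Proof.
move=> mA AI mf mg.
rewrite -ge0_integralD//; [|exact: measurable_norm_sub..].
apply: ge0_le_integral => //.
- apply: measurable_norm_sub => //.
  by apply: strongly_measurable_eq (strongly_measurable_lin 1 mf mg) => x _;
    rewrite scale1r.
- by apply: emeasurable_funD; exact: measurable_norm_sub.
- by move=> x _; rewrite -EFinD lee_fin ler_normD.
Qed.

(** The estimate behind the Bochner integral. For s and t from one approximating sequence it makes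
    the integrals Cauchy; for s and t from two sequences it makes the limit unique. *)
Lemma simple_integral_dist A f s t : @measurable _ TR A -> A `<=` unitI ->
  strongly_measurable f -> simple_fun s -> simple_fun t ->
  ((`|simple_integral A s - simple_integral A t|)%:E <=
   \int[mu]_(x in A) (`|f x - s x|)%:E + \int[mu]_(x in A) (`|f x - t x|)%:E)%E.
Proof.
move=> mA AI mf ss st.
have -> : simple_integral A s - simple_integral A t =
    simple_integral A (fun x => -1 *: t x + s x).
  by rewrite simple_integral_lin// scaleN1r addrC.
have sst := simple_fun_lin (-1) st ss.
apply: (le_trans (simple_integral_norm sst mA AI)).
have m1 := strongly_measurableB mf (simple_strongly_measurable ss).
have m2 := strongly_measurableB mf (simple_strongly_measurable st).
have m1' := strongly_measurableB (simple_strongly_measurable ss) mf.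
rewrite [X in (_ <= X)%E]addeC.
have <- : (\int[mu]_(x in A) (`|s x - f x|)%:E =
           \int[mu]_(x in A) (`|f x - s x|)%:E)%E.
  by apply: eq_integral => x _; rewrite distrC.
apply: le_trans (integral_norm_triangle mA AI m2 m1').
rewrite le_eqVlt; apply/orP; left; apply/eqP; apply: eq_integral => x _.
by congr (`|_|%:E); rewrite scaleN1r addrC [RHS]addrC addrA subrK.
Qed.

Lemma simple_integral_cvg A f (s_ : nat -> R -> X) :
  @measurable _ TR A -> A `<=` unitI -> strongly_measurable f ->
  (forall n, simple_fun (s_ n)) ->
  (\int[mu]_(x in A) (`|f x - s_ n x|)%:E)%E @[n --> \oo] --> 0%E ->
  cvg (simple_integral A (s_ n) @[n --> \oo]).
Proof.
move=> mA AI mf ss /cvge0P sf; apply: cauchy_cvg; apply: cauchy_exP => e e0.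
have e20 : 0 < e / 2 by rewrite divr_gt0.
have {}sf : \forall n \near \oo,
    (\int[mu]_(x in A) (`|f x - s_ n x|)%:E < (e / 2)%:E)%E.
  by apply: sf => // n; exact: integral_ge0.
case: sf => N _ hN; exists (simple_integral A (s_ N)).
exists N => // n /= Nn; rewrite -ball_normE/= -lte_fin.
apply: le_lt_trans (simple_integral_dist mA AI mf (ss N) (ss n)) _.
by rewrite [X in (_ < X%:E)%E](splitr e) EFinD lteD//; apply: hN => /=.
Qed.

Lemma cvg_integral_sub A B f (s_ : nat -> R -> X) :
  @measurable _ TR A -> @measurable _ TR B -> A `<=` B -> B `<=` unitI ->
  strongly_measurable f -> (forall n, simple_fun (s_ n)) ->
  (\int[mu]_(x in B) (`|f x - s_ n x|)%:E)%E @[n --> \oo] --> 0%E ->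
  (\int[mu]_(x in A) (`|f x - s_ n x|)%:E)%E @[n --> \oo] --> 0%E.
Proof.
move=> mA mB AB BI mf ss; apply: (@squeeze_cvge _ _ _ _ (cst 0%E)) (cvg_cst _).
near=> n; rewrite integral_ge0//=; apply: ge0_subset_integral => //.
apply: measurable_norm_sub => //; apply: strongly_measurableB => //.
exact: simple_strongly_measurable.
Unshelve. all: end_near. Qed.

Lemma bochner_uniq A f v w : @measurable _ TR A -> A `<=` unitI ->
  is_bochner_integral A f v -> is_bochner_integral A f w -> v = w.
Proof.
move=> mA AI [mf [s_ [ss sf sv]]] [_ [t_ [st tf tw]]].
have d0 : simple_integral A (s_ n) - simple_integral A (t_ n) @[n --> \oo]
    --> (0 : X).
  apply/cvgr0Pnorm_lt => e e0; have e20 : 0 < e / 2 by rewrite divr_gt0.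
  have i0 (u : nat -> R -> X) n : (0 <= \int[mu]_(x in A) (`|f x - u n x|)%:E)%E.
    exact: integral_ge0.
  have := (cvge0P (i0 t_)).1 tf _ e20; have := (cvge0P (i0 s_)).1 sf _ e20.
  apply: filterS2 => n h1 h2; rewrite -lte_fin.
  apply: le_lt_trans (simple_integral_dist mA AI mf (ss n) (st n)) _.
  by rewrite [X in (_ < X%:E)%E](splitr e) EFinD lteD.
have /cvg_unique : simple_integral A (s_ n) - simple_integral A (t_ n)
    @[n --> \oo] --> v - w by apply: cvgB.
by move=> /(_ (@norm_hausdorff _ _)) /(_ _ d0) /eqP; rewrite subr_eq0 => /eqP.
Qed.

Lemma bochner_lin A a f g v w : @measurable _ TR A -> A `<=` unitI ->
  is_bochner_integral A f v -> is_bochner_integral A g w ->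
  is_bochner_integral A (fun x => a *: f x + g x) (a *: v + w).
Proof.
move=> mA AI [mf [s_ [ss sf sv]]] [mg [t_ [st tg tw]]].
split; first exact: strongly_measurable_lin.
exists (fun n x => a *: s_ n x + t_ n x); split.
- by move=> n; exact: simple_fun_lin.
- have msf n := strongly_measurableB mf (simple_strongly_measurable (ss n)).
  have mtg n := strongly_measurableB mg (simple_strongly_measurable (st n)).
  apply: (@squeeze_cvge _ _ _ _ (cst 0%E) _ (fun n =>
    `|a|%:E * \int[mu]_(x in A) (`|f x - s_ n x|)%:E
    + \int[mu]_(x in A) (`|g x - t_ n x|)%:E)%E); last 2 first.
  + exact: cvg_cst.
  + rewrite -[X in _ --> X](adde0 0%E); apply: cvgeD => //.
    rewrite -[X in _ --> X](mule0 `|a|%:E); apply: cvgeZl => //.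
  near=> n; rewrite integral_ge0//=.
  rewrite -ge0_integralZl//; last exact: measurable_norm_sub.
  rewrite -ge0_integralD//; [|by apply: measurable_funeM; exact: measurable_norm_sub
    |exact: measurable_norm_sub].
  apply: ge0_le_integral => //.
  + apply: measurable_norm_sub => //.
    apply: strongly_measurableB; first exact: strongly_measurable_lin.
    by apply: simple_strongly_measurable; exact: simple_fun_lin.
  + apply: emeasurable_funD; last exact: measurable_norm_sub.
    by apply: measurable_funeM; exact: measurable_norm_sub.
  + move=> x _; rewrite -EFinM -EFinD lee_fin -normrZ.
    apply: le_trans (ler_normD _ _).
    by rewrite scalerBr opprD addrACA.
- under eq_fun do rewrite simple_integral_lin//.
  by apply: cvgD => //; exact: cvgZr.
Unshelve. all: end_near. Qed.

Lemma bochner_eq A f g v : A `<=` unitI -> {in unitI, f =1 g} ->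
  is_bochner_integral A f v -> is_bochner_integral A g v.
Proof.
move=> AI fg [mf [s_ [ss sf sv]]]; split; first exact: strongly_measurable_eq mf.
exists s_; split=> //; rewrite (_ : (fun n => _) =
  (fun n => \int[mu]_(x in A) (`|f x - s_ n x|)%:E)%E)//; apply: funext => n.
by apply: eq_integral => x /set_mem/AI/mem_set Ix; rewrite fg.
Qed.

Lemma bochner_simple A s : @measurable _ TR A -> A `<=` unitI ->
  simple_fun s -> is_bochner_integral A s (simple_integral A s).
Proof.
move=> mA AI ss; split; first exact: simple_strongly_measurable.
exists (fun=> s); split=> //; last exact: cvg_cst.
under eq_fun do under eq_integral do rewrite subrr normr0.
by under eq_fun do rewrite integral0; exact: cvg_cst.
Qed.

Lemma bochner_sub A B f v : @measurable _ TR A -> @measurable _ TR B ->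
  A `<=` B -> B `<=` unitI ->
  is_bochner_integral B f v -> exists w, is_bochner_integral A f w.
Proof.
move=> mA mB AB BI [mf [s_ [ss sf sv]]].
have sfA := cvg_integral_sub mA mB AB BI mf ss sf.
have /cvg_ex[w sw] := simple_integral_cvg mA (subset_trans AB BI) mf ss sfA.
by exists w; split=> //; exists s_.
Qed.

Lemma bochner_norm A f v : @measurable _ TR A -> A `<=` unitI ->
  is_bochner_integral A f v -> (`|v|%:E <= \int[mu]_(x in A) (`|f x|)%:E)%E.
Proof.
move=> mA AI [mf [s_ [ss sf sv]]].
apply/lee_addgt0Pr => e e0; have e20 : 0 < e / 2 by rewrite divr_gt0.
have i0 n : (0 <= \int[mu]_(x in A) (`|f x - s_ n x|)%:E)%E by exact: integral_ge0.
have h1 := (cvge0P i0).1 sf _ e20.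
have /cvgrPdist_lt/(_ _ e20) h2 := sv.
have [n [{}h1 {}h2]] := filter_ex (filterI h1 h2).
have msf := simple_strongly_measurable (ss n).
have mfs := strongly_measurableB mf msf.
have msf' := strongly_measurableB msf mf.
have h3 : (`|simple_integral A (s_ n)|%:E <=
    \int[mu]_(x in A) (`|f x|)%:E + (e / 2)%:E)%E.
  apply: (le_trans (simple_integral_norm (ss n) mA AI)).
  rewrite (_ : (\int[mu]_(x in A) (`|s_ n x|)%:E =
    \int[mu]_(x in A) (`|f x + (s_ n x - f x)|)%:E)%E); last first.
    by apply: eq_integral => x _; rewrite addrC subrK.
  apply: (le_trans (integral_norm_triangle mA AI mf msf')).
  rewrite leeD2l// ltW//; apply: le_lt_trans h1.
  by rewrite le_eqVlt; apply/orP; left; apply/eqP; apply: eq_integral => x _;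
    rewrite distrC.
rewrite [X in (_ + X%:E)%E](splitr e) EFinD addeA.
apply: le_trans (leeD2r _ h3); rewrite -EFinD lee_fin -lerBlDl.
by apply: le_trans (ltW h2); apply: lerB_dist.
Qed.

Lemma bochner_cst A v : @measurable _ TR A -> A `<=` unitI ->
  is_bochner_integral A (fun=> v) (fine (mu A) *: v).
Proof.
move=> mA AI; rewrite -simple_integral_cst//; apply: bochner_simple => //.
exact: simple_fun_cst.
Qed.

Definition bochner_integrable f := exists v, is_bochner_integral unitI f v.

(** A choice of the value, unique by [bochner_uniq], and 0 where there is none. Integrability is
    always required on all of [unitI]; [bintP] passes to measurable subsets. *)
Definition bint A f : X := xget 0 [set v | is_bochner_integral A f v].

Lemma bintP A f : @measurable _ TR A -> A `<=` unitI ->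
  bochner_integrable f -> is_bochner_integral A f (bint A f).
Proof.
move=> mA AI [v fv].
have [w fw] := bochner_sub mA measurable_unitI AI (@subset_refl _ _) fv.
exact: (@xgetPex _ 0 [set v | is_bochner_integral A f v] (ex_intro _ w fw)).
Qed.

Lemma bint_eq A f v : @measurable _ TR A -> A `<=` unitI ->
  is_bochner_integral A f v -> bint A f = v.
Proof.
move=> mA AI fv.
have h := @xgetPex _ 0 [set v | is_bochner_integral A f v] (ex_intro _ v fv).
exact: (bochner_uniq mA AI h fv).
Qed.

Lemma bochner_integrable_lin a f g : bochner_integrable f ->
  bochner_integrable g -> bochner_integrable (fun x => a *: f x + g x).
Proof.
move=> [v fv] [w gw]; exists (a *: v + w).
by apply: bochner_lin => //; exact: measurable_unitI.
Qed.

Lemma bochner_integrable_sum (I : Type) (r : seq I) (a : I -> R)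
    (f : I -> R -> X) : (forall i, bochner_integrable (f i)) ->
  bochner_integrable (fun x => \sum_(i <- r) a i *: f i x).
Proof.
move=> fi; elim: r => [|i r IH].
  under eq_fun do rewrite big_nil.
  by exists (fine (mu unitI) *: 0); apply: bochner_cst => //; exact: measurable_unitI.
by under eq_fun do rewrite big_cons; exact: bochner_integrable_lin.
Qed.

Lemma bint_lin A a f g : @measurable _ TR A -> A `<=` unitI ->
  bochner_integrable f -> bochner_integrable g ->
  bint A (fun x => a *: f x + g x) = a *: bint A f + bint A g.
Proof.
by move=> mA AI fi gi; apply: bint_eq => //; apply: bochner_lin => //; exact: bintP.
Qed.

Lemma bint_sum (I : Type) (r : seq I) A (a : I -> R) (f : I -> R -> X) :
  @measurable _ TR A -> A `<=` unitI -> (forall i, bochner_integrable (f i)) ->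
  bint A (fun x => \sum_(i <- r) a i *: f i x) = \sum_(i <- r) a i *: bint A (f i).
Proof.
move=> mA AI fi; elim: r => [|i r IH].
  rewrite big_nil; under eq_fun do rewrite big_nil.
  by have := bochner_cst 0 mA AI; rewrite scaler0 => /(bint_eq mA AI).
rewrite big_cons; under eq_fun do rewrite big_cons.
by rewrite bint_lin// ?IH//; exact: bochner_integrable_sum.
Qed.

Lemma bintU A B f : @measurable _ TR A -> A `<=` unitI ->
  @measurable _ TR B -> B `<=` unitI -> [disjoint A & B] ->
  bochner_integrable f -> bint (A `|` B) f = bint A f + bint B f.
Proof.
move=> mA AI mB BI AB [v [mf [s_ [ss sf sv]]]].
have mU : @measurable _ TR (A `|` B) by exact: measurableU.
have UI : A `|` B `<=` unitI by move=> x [/AI|/BI].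
have h C : @measurable _ TR C -> C `<=` unitI ->
    simple_integral C (s_ n) @[n --> \oo] --> bint C f.
  move=> mC CI; have cf := cvg_integral_sub mC measurable_unitI CI (@subset_refl _ _) mf ss sf.
  have /cvg_ex[w sw] := simple_integral_cvg mC CI mf ss cf.
  by rewrite (bint_eq mC CI (v := w))//; split=> //; exists s_.
suff hU : simple_integral (A `|` B) (s_ n) @[n --> \oo] --> bint A f + bint B f.
  exact: (cvg_unique (@norm_hausdorff _ _) (h _ mU UI) hU).
under eq_fun do rewrite simple_integralU//.
by apply: cvgD; exact: h.
Qed.

(** Off A the function need not be constant, so it is compared with v through [bochner_norm]: the
    norm of f - v has integral 0 over A. *)
Lemma bint_cst_on A f v : @measurable _ TR A -> A `<=` unitI ->
  bochner_integrable f -> {in A, forall x, f x = v} ->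
  bint A f = fine (mu A) *: v.
Proof.
move=> mA AI fi fv.
have h := bochner_lin (-1) mA AI (bochner_cst v mA AI) (bintP mA AI fi).
have := bochner_norm mA AI h.
rewrite (@eq_integral _ _ _ _ _ (cst 0%E)) ?integral0; last first.
  by move=> x Ax; rewrite fv// scaleN1r addNr normr0.
by rewrite lee_fin normr_le0 scaleN1r addrC subr_eq0 => /eqP.
Qed.

Lemma bochner_integrable_norm f : bochner_integrable f ->
  (\int[mu]_(x in unitI) (`|f x|)%:E < +oo)%E.
Proof.
move=> [v [mf [s_ [ss sf _]]]].
have i0 n : (0 <= \int[mu]_(x in unitI) (`|f x - s_ n x|)%:E)%E.
  exact: integral_ge0.
have [n h1] := filter_ex ((cvge0P i0).1 sf _ ltr01).
have msf := simple_strongly_measurable (ss n).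
rewrite (_ : (\int[mu]_(x in unitI) (`|f x|)%:E =
    \int[mu]_(x in unitI) (`|(f x - s_ n x) + s_ n x|)%:E)%E); last first.
  by apply: eq_integral => x _; rewrite subrK.
apply: le_lt_trans (integral_norm_triangle measurable_unitI (@subset_refl _ _)
  (strongly_measurableB mf msf) msf) _.
have /finite_seqP[ys0 ysE] := (ss n).1.
have rys : range (s_ n) `<=` [set` undup ys0].
  by rewrite ysE => z /=; rewrite mem_undup.
rewrite (integral_simple_norm (ss n) (undup_uniq _) rys) => [|//|//].
  by rewrite lte_add_pinfty ?ltry// (lt_trans h1)// ltry.
exact: measurable_unitI.
Qed.

End Bochner.

(** * Dyadic intervals and dyadic martingales *)

Section DyadicIndex.
Context {R : realType}.
Local Notation mu := (@lebesgue_measure R).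
Local Notation TR := (measurableTypeR R).
Implicit Types (x y : R) (n k : nat).

(** Position of x among the intervals of generation n, meaningful for x in [unitI]. An X-valued
    function on [unitI] is [Delta n]-measurable exactly when it factors through [idx n]. *)
Definition idx n x : nat := Num.truncn ((x + 2^-1) * 2 ^+ n).

Lemma expr2_gt0 n : 0 < 2 ^+ n :> R. Proof. by rewrite exprn_gt0. Qed.

Lemma dyadic_itvP n k x :
  dyadic_itv n k x <-> k%:R <= (x + 2^-1) * 2 ^+ n < k.+1%:R.
Proof.
rewrite /dyadic_itv /= in_itv/= -ler_pdivrMr ?expr2_gt0//.
by rewrite -ltr_pdivlMr ?expr2_gt0// ![- _ + _]addrC lerBlDr ltrBrDr.
Qed.

Lemma unitIP n x : unitI x <-> 0 <= (x + 2^-1) * 2 ^+ n < 2 ^+ n.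
Proof.
rewrite /unitI /= in_itv/= pmulr_lge0 ?expr2_gt0// gtr_pMl ?expr2_gt0//.
by split=> /andP[h1 h2]; apply/andP; split; lra.
Qed.

Lemma dyadic_idx n k x : dyadic_itv n k x -> idx n x = k.
Proof. by move=> /dyadic_itvP; exact: truncn_def. Qed.

Lemma dyadic_itv_idx n x : unitI x -> dyadic_itv n (idx n x) x.
Proof. by move=> /(unitIP n)/andP[x0 _]; apply/dyadic_itvP; exact: truncn_itv. Qed.

Lemma idx_lt n x : unitI x -> (idx n x < 2 ^ n)%N.
Proof. by move=> /(unitIP n)/andP[x0 x1]; rewrite truncn_lt_nat// natrX. Qed.

Lemma dyadic_itv_sub n k : (k < 2 ^ n)%N -> @dyadic_itv R n k `<=` unitI.
Proof.
move=> kn x /dyadic_itvP/andP[h1 h2]; apply/(unitIP n).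
rewrite (le_trans _ h1)//= (lt_le_trans h2)//.
by rewrite -natrX ler_nat.
Qed.

Lemma dyadic_itvE n k : (k < 2 ^ n)%N ->
  dyadic_itv n k = [set x : R | unitI x /\ idx n x = k].
Proof.
move=> kn; apply/seteqP; split=> x /=.
  by move=> Dx; split; [exact: dyadic_itv_sub Dx|exact: dyadic_idx].
by move=> [Ix <-]; exact: dyadic_itv_idx.
Qed.

Lemma idx_half n x : unitI x -> idx n x = (idx n.+1 x)./2.
Proof.
move=> Ix; have /dyadic_itvP/andP[h1 h2] := dyadic_itv_idx n.+1 Ix.
apply: truncn_def; move: h1 h2; rewrite exprS.
have := odd_double_half (idx n.+1 x).
move: (idx n.+1 x)./2 (odd (idx n.+1 x)) => m b <-.
rewrite -addn1 !natrD -addn1 natrD -muln2 natrM.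
by case: b => /= h1 h2; apply/andP; split; lra.
Qed.

Lemma measurable_dyadic n k : @measurable _ TR (dyadic_itv n k).
Proof. exact: measurable_itv. Qed.

Lemma mu_dyadic n k : mu (dyadic_itv n k) = (2 ^- n)%:E.
Proof.
have n0 : 0 < 2 ^- n :> R by rewrite invr_gt0 expr2_gt0.
rewrite /dyadic_itv lebesgue_measure_itv/= lte_fin ltrD2l -[k.+1%:R]natr1 mulrDl.
rewrite ltrDl mul1r n0 -EFinB; congr (_%:E); lra.
Qed.

Lemma dyadic_itvU n k :
  dyadic_itv n k = dyadic_itv n.+1 k.*2 `|` dyadic_itv n.+1 k.*2.+1 :> set R.
Proof.
have e1 : k.*2%:R = 2 * k%:R :> R by rewrite -mul2n natrM.
have e2 : k.*2.+1%:R = 2 * k%:R + 1 :> R by rewrite -addn1 natrD e1.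
have e3 : k.*2.+2%:R = 2 * k%:R + 2 :> R by rewrite -addn2 natrD e1.
have e4 : k.+1%:R = k%:R + 1 :> R by rewrite -addn1 natrD.
apply/seteqP; split=> x.
  move=> /dyadic_itvP/andP[h1 h2].
  have [h|h] := ltP ((x + 2^-1) * 2 ^+ n.+1) k.*2.+1%:R; [left|right];
    apply/dyadic_itvP; rewrite h; move: h1 h2 h;
    rewrite exprS ?e1 ?e2 ?e3 ?e4 => h1 h2 h.
    by rewrite andbT; lra.
  by rewrite /=; lra.
by move=> [|] /dyadic_itvP; rewrite exprS ?e1 ?e2 ?e3 => /andP[h1 h2];
  apply/dyadic_itvP; rewrite e4; apply/andP; split; lra.
Qed.

Lemma dyadic_disj n j k : j != k -> [disjoint @dyadic_itv R n j & dyadic_itv n k].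
Proof.
move=> jk; apply/disj_setPS => x [/dyadic_idx jx /dyadic_idx kx].
by move: jk; rewrite -jx -kx eqxx.
Qed.

Lemma idx0 x : unitI x -> idx 0 x = 0%N.
Proof. by move=> /(idx_lt 0); rewrite expn0 ltnS leqn0 => /eqP. Qed.

Lemma dyadic_itv00 : dyadic_itv 0 0 = unitI :> set R.
Proof.
rewrite dyadic_itvE//; apply/seteqP; split=> x /=; first by case.
by move=> Ix; split=> //; exact: idx0.
Qed.

Lemma child_lt n k : (k < 2 ^ n)%N ->
  (k.*2 < 2 ^ n.+1)%N && (k.*2.+1 < 2 ^ n.+1)%N.
Proof. by move=> kn; rewrite expnS mul2n ltn_double kn ltn_Sdouble. Qed.

(** On the whole line [idx n] takes infinitely many values; sending the complement of [unitI] to 0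
    makes the range finite. *)
Lemma simple_map_idx n : simple_map (fun x : R => if x \in unitI then idx n x else 0%N).
Proof.
split=> [|k].
  apply: (@sub_finite_set _ _ `I_(2 ^ n)); last exact: finite_II.
  move=> _ [x _ <-] /=; case: ifPn => [|_]; last by rewrite expn_gt0.
  by rewrite inE; exact: idx_lt.
set B := [set x | unitI x /\ idx n x = k].
have mB : @measurable _ TR B.
  have [kn|kn] := ltnP k (2 ^ n).
    by rewrite /B -dyadic_itvE//; exact: measurable_dyadic.
  rewrite (_ : B = set0)//; apply/seteqP; split=> // x [/(idx_lt n)] + xk.
  by rewrite xk ltnNge kn.
rewrite (_ : _ @^-1` _ = B `|` (~` unitI `&` [set _ | k = 0%N])).
  apply: measurableU => //; apply: measurableI.
    by apply: measurableC; exact: measurable_unitI.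
  have [->|k0] := eqVneq k 0%N.
    by rewrite (_ : [set _ | _] = setT)//; apply/seteqP.
  by rewrite (_ : [set _ | _] = set0)//; apply/seteqP; split=> // y /= /eqP; rewrite (negbTE k0).
apply/seteqP; split=> x /=; case: ifPn => [/set_mem Ix|/negP Ix].
- by move=> xk; left.
- by move=> <-; right; split=> // /mem_set.
- by move=> [[]//|[]//].
- by move=> [[/mem_set]//|[_ ->]].
Qed.

(** The subsets of [unitI] that do not separate points of equal index form a sigma-algebra
    containing [dyadics n], hence all of [Delta n]. Such a set is a finite union of intervals, which
    gives measurability. *)
Lemma Delta_sub n (A : set R) : Delta n A ->
  [/\ A `<=` unitI, @measurable _ TR A &
      forall x y, unitI y -> idx n x = idx n y -> A x -> A y].
Proof.
have h : Delta n `<=` [set A : set R | A `<=` unitI /\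
    forall x y, unitI y -> idx n x = idx n y -> A x -> A y].
  apply: smallest_sub; first split.
  - by split.
  - move=> B [BI BE]; split=> [x []//|x y Iy xy [Ix nBx]]; split=> // By.
    by apply: nBx; exact: (BE y x).
  - move=> B BE; split=> [x [i _ Bx]|x y Iy xy [i _ Bx]]; first exact: (BE i).1 Bx.
    by exists i => //; exact: (BE i).2 xy Bx.
  - move=> _ [k /= kn <-]; rewrite dyadic_itvE//; split=> [x []//|x y Iy xy [_ xk]].
    by split=> //; rewrite -xy.
move=> /h[AI AE]; split=> //.
rewrite (_ : A = \bigcup_(k in [set k | (k < 2 ^ n)%N /\
    exists2 x, A x & idx n x = k]) dyadic_itv n k).
  apply: fin_bigcup_measurable => [|k _]; last exact: measurable_dyadic.
  by apply: (@sub_finite_set _ _ `I_(2 ^ n)) => [k []|]//; exact: finite_II.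
apply/seteqP; split=> x.
  move=> Ax; exists (idx n x); last exact: dyadic_itv_idx (AI _ Ax).
  by split; [exact: idx_lt (AI _ Ax)|exists x].
by move=> [k [kn [y Ay yk]]]; rewrite dyadic_itvE//= => -[Ix xk];
  apply: (AE y) => //; rewrite yk.
Qed.

Lemma Delta_bigcup n (P : nat -> Prop) :
  Delta n [set x : R | unitI x /\ P (idx n x)].
Proof.
rewrite (_ : [set x | _] = \bigcup_k (if (k < 2 ^ n)%N && `[< P k >]
  then dyadic_itv n k else set0)).
  apply: sigma_algebra_bigcup => k; case: ifPn => [/andP[kn _]|_].
    by apply: sub_sigma_algebra; exists k.
  by move=> S [[S0 _ _] _].
apply/seteqP; split=> x /=.
  move=> [Ix Px]; exists (idx n x) => //; rewrite idx_lt// asboolT//.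
  exact: dyadic_itv_idx.
move=> [k _]; case: ifPn => // /andP[kn /asboolP Pk].
by rewrite dyadic_itvE//= => -[Ix ->].
Qed.

Lemma Delta_unitI n : Delta n (@unitI R).
Proof.
rewrite (_ : unitI = [set x | unitI x /\ True]); first exact: (Delta_bigcup (fun=> True)).
by apply/seteqP; split=> x // [].
Qed.

End DyadicIndex.

(** * Averages, conditional expectations and martingales as trees of values *)

Section DyadicMartingales.
Context {R : realType} {X : completeNormedModType R}.
Local Notation mu := (@lebesgue_measure R).
Local Notation TR := (measurableTypeR R).
Implicit Types (f g : R -> X) (d : nat -> X) (c : nat -> nat -> X) (n k : nat).

(** The value of E(f, Delta_n) on interval k of generation n, which has length 2^-n. *)
Definition avg f n k : X := 2 ^+ n *: bint (dyadic_itv n k) f.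

(** The martingale property of a tree: c n k is the value on interval k of generation n, whose
    halves have indices 2k and 2k + 1. *)
Definition mean_property c := forall n k, (k < 2 ^ n)%N ->
  c n k = 2^-1 *: (c n.+1 k.*2 + c n.+1 k.*2.+1).

Lemma expr2_neq0 n : 2 ^+ n != 0 :> R.
Proof. by rewrite expf_neq0. Qed.

Lemma avg_mean f : bochner_integrable f -> mean_property (avg f).
Proof.
move=> fi n k kn; have /andP[k1 k2] := child_lt kn.
rewrite /avg [in LHS]dyadic_itvU bintU//.
- by rewrite -scalerDr scalerA exprS mulrA mulVf ?mul1r.
- exact: measurable_dyadic.
- exact: dyadic_itv_sub.
- exact: measurable_dyadic.
- exact: dyadic_itv_sub.
- by apply: dyadic_disj; rewrite neq_ltn ltnSn.
Qed.

Lemma bochner_integrable_eq f g : {in unitI, f =1 g} ->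
  bochner_integrable f -> bochner_integrable g.
Proof. by move=> fg [v fv]; exists v; exact: bochner_eq fv. Qed.

Lemma bint_ext (A : set R) f g : @measurable _ TR A -> A `<=` unitI ->
  {in unitI, f =1 g} -> bochner_integrable f -> bint A f = bint A g.
Proof.
by move=> mA AI fg fi; apply/esym/bint_eq => //; apply: bochner_eq fg _ => //; exact: bintP.
Qed.

Lemma avg_eq f g n k : {in unitI, f =1 g} -> bochner_integrable f ->
  (k < 2 ^ n)%N -> avg f n k = avg g n k.
Proof.
move=> fg fi kn; rewrite /avg (bint_ext _ _ fg)//; first exact: measurable_dyadic.
exact: dyadic_itv_sub.
Qed.

Lemma step_integrable n d : bochner_integrable (fun x => d (idx n x)).
Proof.
have := simple_map_comp d (@simple_map_idx R n) => sd.
apply: (@bochner_integrable_eq (fun x : R => d (if x \in unitI then idx n x else 0%N))).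
  by move=> x /= ->.
eexists; apply: bochner_simple => //; exact: measurable_unitI.
Qed.

Lemma avg_cst_on f v n k : bochner_integrable f -> (k < 2 ^ n)%N ->
  (forall x, dyadic_itv n k x -> f x = v) -> avg f n k = v.
Proof.
move=> fi kn fv; rewrite /avg (bint_cst_on _ _ fi (v := v)).
- by rewrite mu_dyadic/= scalerA mulfV ?scale1r// expr2_neq0.
- exact: measurable_dyadic.
- exact: dyadic_itv_sub.
- by move=> x /set_mem; exact: fv.
Qed.

Lemma avg_step n d k : (k < 2 ^ n)%N -> avg (fun x => d (idx n x)) n k = d k.
Proof.
move=> kn; apply: avg_cst_on => //; first exact: step_integrable.
by move=> x /dyadic_idx ->.
Qed.

Lemma avg_lin a f g n k : bochner_integrable f -> bochner_integrable g ->
  (k < 2 ^ n)%N ->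
  avg (fun x => a *: f x + g x) n k = a *: avg f n k + avg g n k.
Proof.
move=> fi gi kn; rewrite /avg bint_lin//.
- by rewrite scalerDr !scalerA mulrC.
- exact: measurable_dyadic.
- exact: dyadic_itv_sub.
Qed.

Lemma avg_sum (I : Type) (r : seq I) (a : I -> R) (f : I -> R -> X) n k :
  (forall i, bochner_integrable (f i)) -> (k < 2 ^ n)%N ->
  avg (fun x => \sum_(i <- r) a i *: f i x) n k =
  \sum_(i <- r) a i *: avg (f i) n k.
Proof.
move=> fi kn; rewrite /avg bint_sum//.
- by rewrite scaler_sumr; apply: eq_bigr => i _; rewrite !scalerA mulrC.
- exact: measurable_dyadic.
- exact: dyadic_itv_sub.
Qed.

Lemma avg_norm f n k : bochner_integrable f -> (k < 2 ^ n)%N ->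
  (`|avg f n k|%:E <= (2 ^+ n)%:E * \int[mu]_(x in dyadic_itv n k) (`|f x|)%:E)%E.
Proof.
move=> fi kn; rewrite /avg normrZ ger0_norm ?exprn_ge0// EFinM.
apply: lee_wpmul2l; first by rewrite lee_fin exprn_ge0.
apply: bochner_norm; [exact: measurable_dyadic|exact: dyadic_itv_sub|].
by apply: bintP => //; [exact: measurable_dyadic|exact: dyadic_itv_sub].
Qed.

Lemma bint_set0 f : bochner_integrable f -> bint set0 f = 0.
Proof.
move=> fi; rewrite (@bint_cst_on _ _ _ _ 0) ?scaler0//.
by move=> x; rewrite inE.
Qed.

(** A set of [Delta n] is a disjoint union of intervals of generation n. They are added one index at
    a time, B m being the part of A with index below m. *)
Lemma Delta_bint n (A : set R) f g : bochner_integrable f ->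
  bochner_integrable g ->
  (forall k, (k < 2 ^ n)%N -> bint (dyadic_itv n k) f = bint (dyadic_itv n k) g) ->
  Delta n A -> bint A f = bint A g.
Proof.
move=> fi gi fg /Delta_sub[AI mA AE].
pose B m := A `&` [set x | (idx n x < m)%N].
have BS m : B m.+1 = B m `|` (A `&` [set x | idx n x = m]).
  apply/seteqP; split=> x /=; rewrite /B/=.
    move=> [Ax]; rewrite ltnS leq_eqVlt => /orP[/eqP->|xm]; first by right.
    by left.
  by move=> [[Ax xm]|[Ax <-]]; split=> //; rewrite ltnS// ltnW.
have BE m : (m < 2 ^ n)%N -> A `&` [set x | idx n x = m] = set0 \/
    A `&` [set x | idx n x = m] = dyadic_itv n m.
  move=> mn; have [[x Ax xm]|nx] := pselect (exists2 x, A x & idx n x = m).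
    right; rewrite dyadic_itvE//; apply/seteqP; split=> y /= [].
      by move=> Ay ym; split=> //; exact: AI.
    by move=> Iy ym; split=> //; apply: (AE x) => //; rewrite xm.
  by left; apply/seteqP; split=> // x [Ax xm]; apply: nx; exists x.
have BI m : B m `<=` unitI by move=> x [/AI].
suff h m : (m <= 2 ^ n)%N -> @measurable _ TR (B m) /\ bint (B m) f = bint (B m) g.
  have -> : A = B (2 ^ n)%N; last exact: (h _ (leqnn _)).2.
  by apply/seteqP; split=> x; [move=> Ax; split=> //=; exact: idx_lt (AI _ Ax)|case].
elim: m => [_|m IH mn].
  rewrite (_ : B 0%N = set0); first by rewrite !bint_set0.
  by apply/seteqP; split=> // x [].
have [mB IHe] := IH (ltnW mn).
rewrite BS; have [->|Em] := BE m mn; first by rewrite setU0.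
have dj : [disjoint B m & dyadic_itv n m].
  apply/disj_setPS => x [[_ /= xm] /dyadic_idx xE].
  by rewrite xE ltnn in xm.
rewrite Em; split; first by apply: measurableU => //; exact: measurable_dyadic.
have mD := @measurable_dyadic R n m; have DI := @dyadic_itv_sub R _ _ mn.
by rewrite (bintU mB (BI m) mD DI dj fi) (bintU mB (BI m) mD DI dj gi) IHe fg.
Qed.

Lemma Delta_measurable_step n f d : (forall x, unitI x -> f x = d (idx n x)) ->
  Delta_measurable n f.
Proof.
move=> fd U oU; rewrite (_ : _ `&` _ = [set x | unitI x /\ U (d (idx n x))]).
  exact: (Delta_bigcup (fun k => U (d k))).
by apply/seteqP; split=> x /= [Ix]; rewrite fd.
Qed.

Lemma Delta_measurable_cst n f x y : Delta_measurable n f ->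
  unitI x -> unitI y -> idx n x = idx n y -> f x = f y.
Proof.
move=> fm Ix Iy xy; apply: contrapT => fxy.
have := fm (~` [set f y]); have oU : open (~` [set f y]).
  by apply: closed_openC; apply: accessible_closed_set1; exact: hausdorff_accessible (@norm_hausdorff _ _).
by move=> /(_ oU) /Delta_sub[_ _ /(_ x y Iy xy)[]] // _; apply.
Qed.

(** A [Delta n]-measurable g is constant on each interval, so its value there is its own average,
    which is that of f. Conversely, equal averages on the intervals give equal integrals on all of
    [Delta n] by [Delta_bint]. *)
Lemma cond_expP n f g : is_cond_exp n f g <->
  bochner_integrable f /\ forall x, unitI x -> g x = avg f n (idx n x).
Proof.
split=> [[gm gE]|[fi gE]].
  have [v [fv gv]] := gE _ (@Delta_unitI R n).
  have fi : bochner_integrable f by exists v.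
  have gi : bochner_integrable g by exists v.
  split=> // x Ix; have kn := idx_lt n Ix.
  have [|w [fw gw]] := gE (dyadic_itv n (idx n x)).
    by apply: sub_sigma_algebra; exists (idx n x).
  have mD := @measurable_dyadic R n (idx n x); have DI := @dyadic_itv_sub R _ _ kn.
  rewrite /avg (bint_eq mD DI fw) -(bint_eq mD DI gw) -/(avg g n _).
  apply/esym/avg_cst_on => // y Dy; apply: (Delta_measurable_cst gm) => //.
    exact: DI.
  exact: dyadic_idx.
split; first exact: Delta_measurable_step gE.
have gi : bochner_integrable g.
  by apply: bochner_integrable_eq (step_integrable n (avg f n)) => x /set_mem Ix; rewrite gE.
move=> A DA; have [AI mA _] := Delta_sub DA.
exists (bint A f); split; first exact: bintP.
rewrite (Delta_bint fi gi _ DA); first exact: bintP.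
move=> k kn; apply: (@scalerI _ _ (2 ^+ n)); first exact: expr2_neq0.
rewrite -/(avg f n k) -/(avg g n k).
rewrite (@avg_cst_on g (avg f n k))// => x Dx.
by rewrite gE ?(dyadic_idx Dx)//; exact: dyadic_itv_sub Dx.
Qed.

(** Replaces martingales by trees of vectors, on which the atomic decomposition can proceed by
    induction. The tree is read off F by averaging F n.+1 at level n. *)
Lemma dyadic_martingaleP (F : nat -> R -> X) : dyadic_martingale F <->
  exists2 c, mean_property c & forall n x, unitI x -> F n x = c n (idx n x).
Proof.
split=> [FM|[c cm FE] n].
  have Fi n : bochner_integrable (F n).
    by have [_ /cond_expP[fi /(_ _ _)FE]] := FM n;
      apply: bochner_integrable_eq (step_integrable n (avg (F n.+1) n)) => x /set_mem Ix; rewrite FE.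
  pose c n k := avg (F n.+1) n k.
  have FE n x : unitI x -> F n x = c n (idx n x).
    by have [_ /cond_expP[_]] := FM n; exact.
  exists c => // n k kn; have /andP[k1 k2] := child_lt kn.
  have h j : (j < 2 ^ n.+1)%N -> c n.+1 j = avg (F n.+1) n.+1 j.
    move=> jn; apply/esym/avg_cst_on => // x Dx.
    by rewrite FE ?(dyadic_idx Dx)//; exact: dyadic_itv_sub Dx.
  by rewrite !h// /c avg_mean.
split; first exact: Delta_measurable_step (FE n).
have FE' x : x \in unitI -> c n.+1 (idx n.+1 x) = F n.+1 x.
  by move=> /set_mem Ix; rewrite FE.
apply/cond_expP; split.
  exact: bochner_integrable_eq FE' (step_integrable _ _).
move=> x Ix; rewrite FE// -(avg_eq FE')//; [|exact: step_integrable|exact: idx_lt].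
have xn := idx_lt n Ix; have /andP[k1 k2] := child_lt xn.
rewrite avg_mean//; last exact: step_integrable.
by rewrite !avg_step// cm.
Qed.

End DyadicMartingales.

(** * Almost everywhere convergence *)

Section AeConvergence.
Context {R : realType} {X : completeNormedModType R}.
Local Notation mu := (@lebesgue_measure R).
Local Notation TR := (measurableTypeR R).
Implicit Types (f : R -> X) (v : X).

(** The sets along which averages are differentiated at x. Off [unitI] they are a filler that lets
    [E_nice] hold at every x. *)
Let E (x : R) (n : nat) : set R :=
  if x \in unitI then dyadic_itv n (idx n x) else [set` `[x, x + 2 ^- n[%R].

Let E_nice x : nicely_shrinking x (E x).
Proof.
have p2 n : 0 < 2 ^- n :> R by rewrite invr_gt0 exprn_gt0.
have muE n : mu (E x n) = (2 ^- n)%:E.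
  rewrite /E; case: ifPn => _; first exact: mu_dyadic.
  rewrite lebesgue_measure_itv/= lte_fin ltrDl p2 -EFinB; congr (_%:E); lra.
split=> [n|].
  by rewrite /E; case: ifPn => _; [exact: measurable_dyadic|exact: measurable_itv].
(* The ball of radius 2^-n around x contains the chosen interval of length 2^-n and is twice as
   long; hence the constant 2. *)
exists (2, fun n => PosNum (p2 n)); split => //=.
- under eq_fun do rewrite -exprVn.
  by apply: cvg_expr; rewrite ger0_norm; lra.
- move=> n y; rewrite /E -ball_normE/=; case: ifPn => [/set_mem Ix|_].
    move: (dyadic_itv_idx n Ix); rewrite /dyadic_itv /= !in_itv/= -[(idx n x).+1%:R]natr1 mulrDl mul1r.
    by move=> /andP[h1 h2] /andP[h3 h4]; rewrite ltr_norml; apply/andP; split; lra.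
  by rewrite /= in_itv/= => /andP[h1 h2]; rewrite ltr_norml; apply/andP; split; have := p2 n; lra.
- move=> n; rewrite muE lebesgue_measure_ball; last exact/ltW/p2.
  by rewrite -EFinM lee_fin mulr2n; lra.
Qed.

Lemma avg_cvg_ae f : bochner_integrable f ->
  {ae mu, forall x, unitI x -> avg f n (idx n x) @[n --> \oo] --> f x}.
Proof.
(* Lebesgue differentiation of |f - v| for the countably many values v taken by
   the simple functions approximating f. *)
move=> fi; have [_ [mf _]] := fi; have [s_ [ss sf]] := mf.
pose ys m := sval (cid ((@finite_seqP _ (range (s_ m))).1 (ss m).1)).
have ysE m : range (s_ m) = [set` ys m] by rewrite /ys; case: cid.
pose v m i := nth 0 (ys m) i.
have fiw w : bochner_integrable (fun x => -1 *: (fun=> w) x + f x).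
  apply: bochner_integrable_lin => //.
  by eexists; apply: bochner_cst => //; exact: measurable_unitI.
(* Lebesgue differentiation is applied to a real function on the whole line: the norm of f - w,
   extended by 0 off [unitI]. *)
pose phi w : R -> R := (fun y => `|-1 *: w + f y|) \_ unitI.
have phiE w : {in unitI, forall x, phi w x = `|-1 *: w + f x|}.
  by move=> x xI; rewrite /phi patchE xI.
have mphi w : measurable_fun setT (phi w : TR -> R).
  apply/(measurable_restrictT _ measurable_unitI).
  by apply: strongly_measurable_norm; have [_ [+ _]] := fiw w.
have phiT w (K : set R) : @measurable _ TR K ->
    (\int[mu]_(x in K) (`|phi w x|)%:E <=
     \int[mu]_(x in unitI) (`|(-1 *: w + f x)%R|)%:E)%E.
  move=> mK; rewrite [leRHS]integral_mkcond.
  rewrite (_ : _ \_ _ = (fun x => (`|phi w x|)%:E)).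
    apply: ge0_subset_integral => //.
    by apply/measurable_EFinP; apply: measurableT_comp => //; exact: mphi.
  by apply: funext => x; rewrite /phi !patchE; case: ifP; rewrite ?normr_id ?normr0.
have lphi w : locally_integrable setT (phi w).
  split; [exact: mphi|exact: openT|].
  move=> K _ cK; apply: le_lt_trans (bochner_integrable_norm (fiw w)).
  apply: phiT; exact: compact_measurable.
(* The vectors v m i are countably many, so one null set serves them all; an index i past the end of
   the list yields the default value 0. *)
have : {ae mu, forall x, forall m i, lebesgue_pt (phi (v m i)) x}.
  apply: ae_foralln => m; apply: ae_foralln => i.
  exact: lebesgue_differentiation.
move=> [N [mN N0 NE]]; exists N; split=> //; apply: subset_trans NE => x /=.
apply: contra_not => px Ix; apply/cvgrPdist_lt => e e0.
have e20 : 0 < e / 2 by rewrite divr_gt0.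
(* For v = s_ m x within e / 2 of f x, the averages of the norm of f - v tend to the norm of f x -
   v, hence are eventually below e / 2. *)
have /cvgrPdist_lt/(_ _ e20) /filter_ex[m fm] := sf x Ix.
have : range (s_ m) (s_ m x) by exists x.
rewrite ysE /= => /nthP-/(_ 0)[i _ vE].
have {vE} vE : v m i = s_ m x by [].
have := nice_lebesgue_differentiation E_nice (lphi (v m i)) (px m i).
rewrite phiE ?inE// vE scaleN1r addrC => h.
have xI : x \in unitI by rewrite inE.
have {}h : \forall n \near \oo, ((mu (E x n))^-1 *
    \int[mu]_(y in E x n) (phi (v m i) y)%:E < (e / 2)%:E)%E.
  by rewrite vE; apply: (h [set y | (y < (e / 2)%:E)%E]); apply: open_ereal_lt'; rewrite lte_fin.
move: h; apply: filterS => n; rewrite /E xI mu_dyadic inver.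
rewrite gt_eqF ?invr_gt0 ?exprn_gt0// invrK => h.
have kn := idx_lt n Ix.
have DI := @dyadic_itv_sub R _ _ kn.
have : (`|avg (fun y => -1 *: (fun=> v m i) y + f y) n (idx n x)|%:E < (e / 2)%:E)%E.
  apply: le_lt_trans (avg_norm (fiw (v m i)) kn) _.
  move: h; congr (_ * _ < _)%E; apply: eq_integral => y /set_mem/DI/mem_set yI.
  by rewrite phiE.
rewrite avg_lin//; last by eexists; apply: bochner_cst => //; exact: measurable_unitI.
rewrite (@avg_cst_on _ _ (fun=> v m i) (v m i))//; last first.
  by eexists; apply: bochner_cst => //; exact: measurable_unitI.
rewrite lte_fin scaleN1r vE => h'.
rewrite (splitr e); apply: le_lt_trans (ltrD fm h').
apply: le_trans (ler_distD (s_ m x) _ _) _; rewrite lerD2l distrC.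
by rewrite addrC.
Qed.
End AeConvergence.

(** * The p-masses and their subadditivity *)

Section Powers.
Context {R : realType} (p : R).
Hypothesis p0 : 0 < p.
Implicit Types (a b : R) (x y : \bar R).

Lemma lee_poweR2 x y : (0 <= x)%E -> (0 <= y)%E ->
  (x `^ p <= y `^ p)%E = (x <= y)%E.
Proof.
move=> x0 y0; apply/idP/idP => [xy|xy]; last first.
  by apply: gt0_ler_poweR => //; [exact: ltW|rewrite in_itv/= x0 leey|rewrite in_itv/= y0 leey].
have := @gt0_ler_poweR R p^-1; rewrite invr_ge0 => /(_ (ltW p0)) /(_ _ _ _ _ xy).
rewrite -!poweRrM divff ?gt_eqF// !poweRe1//; apply; by rewrite in_itv/= poweR_ge0 leey.
Qed.

Lemma poweR_invK x : (0 <= x)%E -> ((x `^ p^-1) `^ p)%E = x.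
Proof. by move=> x0; rewrite -poweRrM mulVf ?gt_eqF// poweRe1. Qed.

Lemma root_ge x y : (0 <= x)%E -> (0 <= y)%E ->
  (y <= x `^ p^-1)%E = (y `^ p <= x)%E.
Proof. by move=> x0 y0; rewrite -lee_poweR2 ?poweR_ge0// poweR_invK. Qed.

Lemma root_lt x y : (0 <= x)%E -> (0 <= y)%E ->
  (x `^ p^-1 < y)%E = (x < y `^ p)%E.
Proof. by move=> x0 y0; rewrite !ltNge root_ge. Qed.

Lemma root_lty x : (x `^ p^-1 < +oo)%E = (x < +oo)%E.
Proof.
apply/idP/idP; last exact: poweR_lty.
by apply: lty_poweRy; rewrite invr_neq0// gt_eqF.
Qed.

Hypothesis p1 : p <= 1.

(** Since p <= 1, c / s <= (c / s)^p for 0 <= c <= s. Take s = a + b and add the cases c = a and c =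
    b. *)
Lemma powR_subadd a b : 0 <= a -> 0 <= b -> (a + b) `^ p <= a `^ p + b `^ p.
Proof.
move=> a0 b0; have [s0|s0] := leP (a + b) 0.
  have -> : a = 0 by lra.
  have -> : b = 0 by lra.
  by rewrite addr0 powR0 ?gt_eqF// addr0.
have h c : 0 <= c -> c <= a + b -> c * ((a + b) `^ p / (a + b)) <= c `^ p.
  move=> c0 cab; have [->|cn0] := eqVneq c 0; first by rewrite mul0r powR_ge0.
  have cp : 0 < c by rewrite lt_def cn0.
  have sp : 0 < (a + b) `^ p by rewrite powR_gt0.
  have -> : c `^ p = (a + b) `^ p * (c / (a + b)) `^ p.
    by rewrite -powRM ?divr_ge0 ?ltW// mulrC divfK// gt_eqF.
  rewrite mulrCA ler_pM2l//; apply: ger1_powR => //.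
  by rewrite divr_gt0//= ler_pdivrMr// mul1r.
have := lerD (h a a0 _) (h b b0 _); rewrite -mulrDl => /(_ _ _).
rewrite lerDl b0 lerDr a0 => /(_ isT isT); apply: le_trans.
by rewrite mulrCA divff ?mulr1// gt_eqF.
Qed.

Lemma powR_sum (I : Type) (r : seq I) (F : I -> R) : (forall i, 0 <= F i) ->
  (\sum_(i <- r) F i) `^ p <= \sum_(i <- r) F i `^ p.
Proof.
move=> F0; elim: r => [|i r IH]; first by rewrite !big_nil powR0// gt_eqF.
rewrite !big_cons; apply: le_trans (powR_subadd (F0 i) _) _.
  exact: sumr_ge0.
by rewrite lerD2l.
Qed.

Lemma poweR_subadd x y : (0 <= x)%E -> (0 <= y)%E ->
  ((x + y) `^ p <= x `^ p + y `^ p)%E.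
Proof.
move: x y => [a| |] [b| |]//; rewrite ?lee_fin => a0 b0.
- exact: powR_subadd.
- by rewrite [leRHS]addeC poweRyr ?gt_eqF// addye ?leey// -ltNye (lt_le_trans _ (poweR_ge0 _ _)).
- by rewrite poweRyr ?gt_eqF// addye ?leey// -ltNye (lt_le_trans _ (poweR_ge0 _ _)).
- by rewrite poweRyr ?gt_eqF// leey.
Qed.

End Powers.

Section QuasiNorms.
Context {R : realType} {X : completeNormedModType R} (p : R).
Hypothesis p0 : 0 < p.
Local Notation mu := (@lebesgue_measure R).
Local Notation TR := (measurableTypeR R).
Implicit Types (f g : R -> X) (F G : nat -> R -> X).

(** [lp] and [hp] are the p-th powers of the two quasi-norms. For p <= 1 they are subadditive, which
    for p < 1 the quasi-norms in general are not. *)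
Definition lp f : \bar R := (\int[mu]_(x in unitI) (`|f x| `^ p)%:E)%E.

Definition hp F : \bar R := (\int[mu]_(x in unitI) (maximal_fun F x `^ p))%E.

Lemma lp_ge0 f : (0 <= lp f)%E.
Proof. by apply: integral_ge0 => x _; rewrite lee_fin powR_ge0. Qed.

Lemma hp_ge0 F : (0 <= hp F)%E.
Proof. by apply: integral_ge0 => x _; exact: poweR_ge0. Qed.

Lemma Lnorm_restrict (h : R -> \bar R) : (forall x, 0 <= h x)%E ->
  ('N[mu]_p%:E[h \_ unitI] = (\int[mu]_(x in unitI) (h x `^ p)) `^ p^-1)%E.
Proof.
move=> h0; rewrite unlock; congr poweR; rewrite [RHS]integral_mkcond.
apply: eq_integral => x _; rewrite !patchE; case: ifPn => _.
  by rewrite gee0_abs.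
by rewrite (_ : point = 0%E)// abse0 poweR0r// gt_eqF.
Qed.

Lemma Lp_normE f : Lp_norm p%:E f = (lp f `^ p^-1)%E.
Proof.
rewrite /Lp_norm Lnorm_restrict; last by move=> x; rewrite lee_fin.
by congr poweR; apply: eq_integral => x _; rewrite poweR_EFin.
Qed.

Lemma maximal_ge F n x : ((`|F n x|)%:E <= maximal_fun F x)%E.
Proof. by apply: ereal_sup_ubound; exists n. Qed.

Lemma maximal_ge0 F x : (0 <= maximal_fun F x)%E.
Proof. by apply: le_trans (maximal_ge F 0 x); rewrite lee_fin. Qed.

Lemma maximal_le F x (y : \bar R) : (forall n, (`|F n x|)%:E <= y)%E ->
  (maximal_fun F x <= y)%E.
Proof. by move=> h; apply: ge_ereal_sup => _ [n _ <-]. Qed.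

Lemma Hm_normE F : Hm_norm p F = (hp F `^ p^-1)%E.
Proof. by rewrite /Hm_norm Lnorm_restrict// => x; exact: maximal_ge0. Qed.

Lemma Lp_cvgP (f_ : nat -> R -> X) f : Lp_cvg p%:E f_ f <->
  forall e : R, 0 < e ->
    \forall n \near \oo, (lp (fun x => f_ n x - f x)%R < e%:E)%E.
Proof.
rewrite /Lp_cvg; under eq_fun do rewrite Lp_normE.
apply: iff_trans (cvge0P _) _; first by move=> n; exact: poweR_ge0.
split=> h e e0.
  have := h (e `^ p^-1) (powR_gt0 _ e0); apply: filterS => n.
  rewrite root_lt ?lp_ge0// ?lee_fin ?powR_ge0// poweR_EFin -powRrM mulVf ?gt_eqF//.
  by rewrite powRr1// ltW.
have := h (e `^ p) (powR_gt0 _ e0); apply: filterS => n.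
by rewrite root_lt ?lp_ge0// lee_fin ltW.
Qed.

Lemma measurable_lp f : strongly_measurable f ->
  measurable_fun unitI (fun x : TR => (`|f x| `^ p)%:E).
Proof.
move=> mf; apply/measurable_EFinP.
exact: (measurableT_comp (@measurable_powR R p) (strongly_measurable_norm mf)).
Qed.

Lemma measurable_maximal F : (forall n, strongly_measurable (F n)) ->
  measurable_fun unitI (fun x : TR => maximal_fun F x).
Proof.
move=> mF.
rewrite (_ : (fun x => _) = (fun x : TR => esups (fun n => (`|F n x|)%:E) 0)).
  by apply: measurable_fun_esups => n; apply: measurable_norm_sub.
apply: funext => x; rewrite /maximal_fun /esups /sdrop/=; congr ereal_sup.
by apply/seteqP; split=> _ [n _ <-]; exists n.
Qed.

Lemma measurable_hp F : (forall n, strongly_measurable (F n)) ->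
  measurable_fun unitI (fun x : TR => (maximal_fun F x `^ p)%E).
Proof.
move=> mF; exact: (measurableT_comp (@measurable_poweR R p) (measurable_maximal mF)).
Qed.

Lemma lp_eq f g : {in unitI, f =1 g} -> lp f = lp g.
Proof. by move=> fg; apply: eq_integral => x xI; rewrite fg. Qed.

Lemma hp_eq F G : (forall n, {in unitI, F n =1 G n}) -> hp F = hp G.
Proof.
move=> FG; apply: eq_integral => x xI; congr poweR; congr ereal_sup.
by apply/seteqP; split=> _ [n _ <-]; exists n => //; rewrite FG.
Qed.

Lemma lp_distC f g : lp (fun x => f x - g x) = lp (fun x => g x - f x).
Proof. by apply: eq_integral => x _; rewrite distrC. Qed.

Lemma lp_le_hp F n : (forall n, strongly_measurable (F n)) -> (lp (F n) <= hp F)%E.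
Proof.
move=> mF; apply: ge0_le_integral => //.
- exact: measurable_unitI.
- exact: measurable_lp.
- exact: measurable_hp.
- move=> x _; rewrite -poweR_EFin lee_poweR2//; first exact: maximal_ge.
  exact: maximal_ge0.
Qed.

Lemma hp_le F (h : R -> \bar R) : (forall n, strongly_measurable (F n)) ->
  measurable_fun unitI (h : TR -> \bar R) -> (forall x, 0 <= h x)%E ->
  (forall n x, unitI x -> (`|F n x| `^ p)%:E <= h x)%E ->
  (hp F <= \int[mu]_(x in unitI) h x)%E.
Proof.
move=> mF mh h0 Fh; apply: ge0_le_integral => //.
- exact: measurable_unitI.
- by move=> x _; exact: poweR_ge0.
- exact: measurable_hp.
- move=> x Ix; rewrite -[h x](poweR_invK p0)// lee_poweR2 ?poweR_ge0//; last exact: maximal_ge0.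
  apply: maximal_le => n; rewrite root_ge// ?lee_fin//.
  by rewrite poweR_EFin; exact: Fh.
Qed.

Hypothesis p1 : p <= 1.

Lemma lp_triangle f g : strongly_measurable f -> strongly_measurable g ->
  (lp (fun x => f x + g x)%R <= lp f + lp g)%E.
Proof.
move=> mf mg; rewrite /lp -ge0_integralD//; try exact: measurable_unitI; try exact: measurable_lp;
  try by move=> x _; exact: poweR_ge0.
apply: ge0_le_integral => //; try exact: measurable_unitI.
- apply: measurable_lp.
  by apply: strongly_measurable_eq (strongly_measurable_lin 1 mf mg) => x _;
    rewrite scale1r.
- by apply: emeasurable_funD; exact: measurable_lp.
- move=> x _; rewrite -EFinD lee_fin; apply: le_trans (powR_subadd p0 p1 _ _) => //.
  by apply: ge0_ler_powR; rewrite ?nnegrE ?addr_ge0 ?(ltW p0)// ler_normD.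
Qed.

Lemma hp_triangle F G : (forall n, strongly_measurable (F n)) ->
  (forall n, strongly_measurable (G n)) ->
  (hp (fun n x => F n x + G n x)%R <= hp F + hp G)%E.
Proof.
move=> mF mG; rewrite [in leRHS]/hp -ge0_integralD//; try exact: measurable_unitI; try exact: measurable_hp;
  try by move=> x _; exact: poweR_ge0.
apply: ge0_le_integral => //.
- exact: measurable_unitI.
- by move=> x _; exact: poweR_ge0.
- apply: measurable_hp => n.
  by apply: strongly_measurable_eq (strongly_measurable_lin 1 (mF n) (mG n)) => x _;
    rewrite scale1r.
- by apply: emeasurable_funD; exact: measurable_hp.
- move=> x _; apply: le_trans (poweR_subadd p0 p1 _ _); last 2 first.
    exact: maximal_ge0.
    exact: maximal_ge0.
  rewrite lee_poweR2// ?adde_ge0 ?maximal_ge0//.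
  apply: maximal_le => n; apply: le_trans (leeD (maximal_ge F n x) (maximal_ge G n x)).
  by rewrite -EFinD lee_fin ler_normD.
Qed.

End QuasiNorms.

(** * Convergence of truncated martingales and of averages of bounded functions *)

Section DominatedConvergence.
Context {R : realType} {X : completeNormedModType R} (p : R).
Hypothesis p0 : 0 < p.
Local Notation mu := (@lebesgue_measure R).
Local Notation TR := (measurableTypeR R).
Implicit Types (f g : R -> X) (F G : nat -> R -> X).

Lemma ae_impl2 (P Q S : R -> Prop) : {ae mu, forall x, P x} ->
  {ae mu, forall x, Q x} -> (forall x, P x -> Q x -> S x) -> {ae mu, forall x, S x}.
Proof.
move=> hP hQ PQS; apply: negligibleS (negligibleU hP hQ) => x /= nS.
have [Px|] := pselect (P x); last by left.
by right=> Qx; apply: nS; exact: PQS.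
Qed.

Lemma step_strongly_measurable n (d : nat -> X) f :
  (forall x, unitI x -> f x = d (idx n x)) -> strongly_measurable f.
Proof.
move=> fE; have [_ [md _]] := step_integrable n d.
by apply: strongly_measurable_eq md => x /set_mem Ix; rewrite fE.
Qed.

(** Almost everywhere F n x converges, so the maximal function of the part of F beyond level N tends
    to 0; it is dominated by twice that of F. The limit function f is what the intersection with L_1
    in [Hm_ring] provides: for general X a martingale with integrable maximal function need not
    converge. *)
Lemma truncation_cvg F f : bochner_integrable f ->
  (forall n x, unitI x -> F n x = avg f n (idx n x)) -> (hp p F < +oo)%E ->
  forall e : R, 0 < e -> exists N,
    (hp p (fun n x => F n x - F (minn n N) x)%R < e%:E)%E.
Proof.
move=> fi FE hF.
have mF n : strongly_measurable (F n) by exact: step_strongly_measurable (FE n).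
pose D N n x := F n x - F (minn n N) x.
have mD N n : strongly_measurable (D N n) by exact: strongly_measurableB.
pose g_ (N : nat) (x : TR) := (maximal_fun (D N) x `^ p)%E.
have DF N x : (maximal_fun (D N) x <= 2%:E * maximal_fun F x)%E.
  apply: maximal_le => n; rewrite mule_natl mule2n.
  apply: le_trans (leeD (maximal_ge F n x) (maximal_ge F (minn n N) x)).
  by rewrite -EFinD lee_fin ler_normB.
have tri (u v w : X) : `|u - v| <= `|w - u| + `|w - v|.
  by rewrite (distrC w u); exact: ler_distD.
have gae : {ae mu, forall x, unitI x -> g_ N x @[N --> \oo] --> (cst 0%E : TR -> \bar R) x}.
  apply: (ae_impl2 (avg_cvg_ae fi) (avg_cvg_ae fi)) => x fx _ Ix.
  apply/cvge0P => [N|e e0]; first exact: poweR_ge0.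
  (* The supremum is only bounded by a weak inequality; starting from e / 2 makes the final one
     strict. *)
  set e' := (e / 2) `^ p^-1.
  have e'0 : 0 < e' by rewrite powR_gt0// divr_gt0.
  have e'20 : 0 < e' / 2 by rewrite divr_gt0.
  have /cvgrPdist_lt/(_ _ e'20)[N0 _ hN] := fx Ix.
  exists N0 => // N /= NN; apply: (@le_lt_trans _ _ (e / 2)%:E); last first.
    by rewrite lte_fin ltr_pdivrMr// ltr_pMr//; lra.
  have -> : (e / 2)%:E = (e'%:E `^ p)%E.
    by rewrite poweR_EFin -powRrM mulVf ?gt_eqF// powRr1// divr_ge0// ltW.
  rewrite /g_ lee_poweR2//; [|exact: maximal_ge0|by rewrite lee_fin ltW].
  apply: maximal_le => n; rewrite lee_fin /D.
  have [nN|Nn] := leqP n N; first by rewrite subrr normr0 ltW.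
  rewrite !FE//.
  have h1 := hN n (ltnW (leq_ltn_trans NN Nn)); have h2 := hN N NN.
  rewrite (splitr e') ltW//; apply: le_lt_trans (ltrD h1 h2).
  exact: tri.
have ig : mu.-integrable unitI (fun x : TR => ((2 `^ p)%:E * maximal_fun F x `^ p)%E).
  apply/integrableP; split.
    by apply: measurable_funeM; exact: measurable_hp.
  under eq_integral do rewrite gee0_abs ?mule_ge0 ?poweR_ge0 ?lee_fin ?powR_ge0//.
  rewrite ge0_integralZl ?lee_fin ?powR_ge0//.
  - by apply: lte_mul_pinfty; rewrite ?lee_fin ?powR_ge0.
  - exact: measurable_unitI.
  - exact: measurable_hp.
  - by move=> x _; exact: poweR_ge0.
have [|||_ _ h] := dominated_convergence measurable_unitI _ _ gae ig.
- by move=> N; exact: measurable_hp.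
- exact: measurable_cst.
- apply: (ae_impl2 (avg_cvg_ae fi) (avg_cvg_ae fi)) => x _ _ N Ix.
  rewrite gee0_abs ?poweR_ge0// -poweR_EFin -poweRM ?lee_fin ?maximal_ge0//.
  by rewrite lee_poweR2 ?maximal_ge0// mule_ge0// maximal_ge0.
move=> e e0; move: h; rewrite integral0 => /cvge0P h.
have [|N hN] := filter_ex (h _ e e0); last by exists N.
by move=> n; apply: integral_ge0 => x _; exact: poweR_ge0.
Qed.

Lemma avg_ae_le f (M : R) n k : 0 <= M -> bochner_integrable f ->
  {ae mu, forall x, unitI x -> `|f x| <= M} -> (k < 2 ^ n)%N -> `|avg f n k| <= M.
Proof.
move=> M0 fi fM kn; have [_ [mf _]] := fi; have DI := @dyadic_itv_sub R _ _ kn.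
rewrite -lee_fin; apply: le_trans (avg_norm fi kn) _.
rewrite -lee_pdivlMl ?exprn_gt0//.
rewrite -(mu_dyadic n k) muleC.
under eq_integral do rewrite -normr_id -abse_EFin.
apply: integral_le_bound.
- exact: measurable_dyadic.
- exact: measurable_norm_sub.
- by rewrite lee_fin.
- apply: (ae_impl2 fM fM) => y fy _ Dy; rewrite gee0_abs ?lee_fin//.
  by apply: fy; exact: DI.
Qed.

(** The averages inherit the bound M, so the constant (2 M)^p dominates on an interval of measure 1.
    This is meant for finite sums of atoms. *)
Lemma avg_cvg_lp f (M : R) : 0 <= M -> bochner_integrable f ->
  {ae mu, forall x, unitI x -> `|f x| <= M} ->
  forall e : R, 0 < e ->
    \forall n \near \oo, (lp p (fun x => avg f n (idx n x) - f x)%R < e%:E)%E.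
Proof.
move=> M0 fi fM; have [_ [mf _]] := fi.
have avgM n (x : R) : unitI x -> `|avg f n (idx n x)| <= M.
  by move=> Ix; exact: (avg_ae_le M0 fi fM (idx_lt n Ix)).
have md n : strongly_measurable (fun x => avg f n (idx n x) - f x).
  by apply: strongly_measurableB => //; exact: (@step_strongly_measurable n (avg f n)).
pose g_ n (x : TR) := (`|avg f n (idx n x) - f x| `^ p)%:E.
have gae : {ae mu, forall x, unitI x -> g_ n x @[n --> \oo] --> (cst 0%E : TR -> \bar R) x}.
  apply: (ae_impl2 (avg_cvg_ae fi) fM) => x fx _ Ix.
  apply/cvge0P => [N|e e0]; first by rewrite lee_fin powR_ge0.
  have e'0 : 0 < e `^ p^-1 by rewrite powR_gt0.
  have /cvgrPdist_lt/(_ _ e'0) := fx Ix; apply: filterS => n h.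
  have -> : e = (e `^ p^-1) `^ p by rewrite -powRrM mulVf ?gt_eqF// powRr1// ltW.
  by rewrite lte_fin; apply: gt0_ltr_powR; rewrite ?nnegrE ?powR_ge0// distrC.
have ig : mu.-integrable unitI (fun _ : TR => ((M + M) `^ p)%:E).
  apply/integrableP; split; first exact: measurable_cst.
  apply: (@le_lt_trans _ _ (`|((M + M) `^ p)%:E| * mu unitI)%E).
    by rewrite -integral_cst//; exact: measurable_unitI.
  by rewrite mu_unitI mule1 ltry.
have [|||_ _ h] := dominated_convergence measurable_unitI _ _ gae ig.
- by move=> N; exact: measurable_lp.
- exact: measurable_cst.
- apply: (ae_impl2 fM fM) => x fx _ n Ix.
  rewrite gee0_abs ?lee_fin ?powR_ge0//.
  apply: ge0_ler_powR; rewrite ?nnegrE ?(ltW p0) ?addr_ge0//.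
  by apply: le_trans (ler_normB _ _) _; apply: lerD; [exact: avgM|exact: fx].
by move: h; rewrite integral0 => /cvge0P; apply=> n; exact: lp_ge0.
Qed.

End DominatedConvergence.

(** * From atoms to martingales *)

Section Atoms.
Context {R : realType} {X : completeNormedModType R} (p : R).
Hypothesis p0 : 0 < p.
Local Notation mu := (@lebesgue_measure R).
Local Notation TR := (measurableTypeR R).
Implicit Types (f g a : R -> X).

Lemma idx_coarse m n (x y : R) : (m <= n)%N -> unitI x -> unitI y ->
  idx n x = idx n y -> idx m x = idx m y.
Proof.
move=> mn Ix Iy; rewrite -(subnK mn); elim: (n - m)%N => // d IH.
by rewrite addSn => h; apply: IH; rewrite idx_half// h -idx_half.
Qed.

Definition ae_bounded f := exists2 M : R, 0 <= M &
  {ae mu, forall x, unitI x -> `|f x| <= M}.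

Lemma ae_bounded_lin (b : R) f g : ae_bounded f -> ae_bounded g ->
  ae_bounded (fun x => b *: f x + g x).
Proof.
move=> [M M0 fM] [N N0 gN]; exists (`|b| * M + N); first by rewrite addr_ge0 ?mulr_ge0.
apply: (ae_impl2 fM gN) => x fx gx Ix; apply: le_trans (ler_normD _ _) _.
by rewrite normrZ; apply: lerD; [rewrite ler_wpM2l// fx|exact: gx].
Qed.

Lemma aeW (P : R -> Prop) : (forall x, P x) -> {ae mu, forall x, P x}.
Proof. by move=> h; apply: negligibleS (negligible_set0 _) => x /= []. Qed.

Lemma Lp_norm_oo_le f (M : R) : (Lp_norm +oo%E f <= M%:E)%E ->
  {ae mu, forall x, unitI x -> `|f x| <= M}.
Proof.
rewrite /Lp_norm unlock ifT; last first.
  apply: (@lt_le_trans _ _ (mu unitI)); first by rewrite mu_unitI lte01.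
  by apply: le_measure; rewrite ?inE//; exact: measurable_unitI.
move=> /ess_supP h; apply: (ae_impl2 h h) => x /= + _ Ix.
by rewrite patchE mem_set//= normr_id lee_fin.
Qed.

Lemma bint_off_zero n k a : bochner_integrable a -> (k < 2 ^ n)%N ->
  (forall x, unitI x -> ~ dyadic_itv n k x -> a x = 0) ->
  bint (dyadic_itv n k) a = bint unitI a.
Proof.
move=> ai kn a0; have DI := @dyadic_itv_sub R _ _ kn.
have mD := @measurable_dyadic R n k.
have mC : @measurable _ TR (unitI `\` dyadic_itv n k).
  by apply: measurableD => //; exact: measurable_unitI.
have CI : unitI `\` dyadic_itv n k `<=` @unitI R by move=> x [].
rewrite -[in RHS](setDUK DI).
rewrite bintU//; last by apply/disj_setPS => x [Dx [_ nDx]].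
rewrite [X in _ + X](@bint_cst_on _ _ _ _ 0)//.
  by rewrite scaler0 addr0.
by move=> x /set_mem [Ix nDx]; exact: a0.
Qed.

(** At level m the averages vanish, by the support condition and the mean zero; hence so do those at
    coarser levels, by averaging. An interval of a finer level lies in the support interval, where
    the bound on a applies, or is disjoint from it. *)
Lemma dyadic_atom_avg m k0 a n (x : R) : bochner_integrable a -> (k0 < 2 ^ m)%N ->
  (forall x, unitI x -> ~ dyadic_itv m k0 x -> a x = 0) ->
  {ae mu, forall x, unitI x -> `|a x| <= (2 ^- m) `^ (- p^-1)} ->
  bint unitI a = 0 -> unitI x ->
  `|avg a n (idx n x)| <= ((fun=> (2 ^- m) `^ (- p^-1)) \_ (dyadic_itv m k0)) x.
Proof.
move=> ai k0m a0 aM a_mean Ix.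
have off n' k : (k < 2 ^ n')%N ->
    (forall y : R, dyadic_itv n' k y -> ~ dyadic_itv m k0 y) -> avg a n' k = 0.
  move=> kn dis; apply: avg_cst_on => // y Dy; apply: a0; last exact: dis.
  exact: dyadic_itv_sub Dy.
have avgm k : (k < 2 ^ m)%N -> avg a m k = 0.
  move=> km; have [->|kk0] := eqVneq k k0.
    by rewrite /avg bint_off_zero// a_mean scaler0.
  apply: off => // y /dyadic_idx yk /dyadic_idx yk0.
  by move: kk0; rewrite -yk -yk0 eqxx.
have [nm|mn] := leqP n m.
  suff -> : avg a n (idx n x) = 0.
    by rewrite normr0 patchE; case: ifP => // _; exact: powR_ge0.
  have h d : (d <= m)%N -> forall k, (k < 2 ^ (m - d))%N -> avg a (m - d) k = 0.
    elim: d => [_ k|d IH dm k km]; first by rewrite subn0; exact: avgm.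
    have e : (m - d = (m - d.+1).+1)%N by rewrite subnSK.
    have /andP[k1 k2] := child_lt km; rewrite -e in k1 k2.
    by rewrite avg_mean// -e !IH ?(ltnW dm)// addr0 scaler0.
  by rewrite -(subKn nm) h ?leq_subr//; exact: idx_lt.
rewrite patchE; case: ifPn => [_|/negP xJ].
  by apply: avg_ae_le => //; exact: idx_lt.
rewrite off ?normr0//; first exact: idx_lt.
move=> y Dy /dyadic_idx yk; apply: xJ; apply/mem_set.
have Iy : unitI y by exact: dyadic_itv_sub (idx_lt n Ix) _ Dy.
rewrite -yk -(@idx_coarse _ _ x y (ltnW mn))//; first exact: dyadic_itv_idx.
exact/esym/dyadic_idx.
Qed.

Lemma atom_bound_pow m : ((2 ^- m) `^ (- p^-1)) `^ p = 2 ^+ m :> R.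
Proof.
rewrite -powRrM mulNr mulVf ?gt_eqF// powR_inv1 ?invrK//.
Qed.

(** The majorant is 2^m = 1 / |J| on J for an atom on an interval J of generation m, and 1 for a
    constant. One function serves all levels, so sums of atoms can be treated pointwise. *)
Lemma atom_majorant a : atoms p a -> exists phi : R -> R,
  [/\ measurable_fun unitI (phi : TR -> R), forall x, 0 <= phi x,
      (\int[mu]_(x in unitI) (phi x)%:E <= 1)%E,
      forall n x, unitI x -> `|avg a n (idx n x)| `^ p <= phi x
    & [/\ bochner_integrable a, (lp p a <= 1)%E & ae_bounded a]].
Proof.
move=> [|[v v1 av]].
  move=> [m [_ [[k0 /= k0m <-] [ma a0 /Lp_norm_oo_le aM a_mean]]]].
  have ai : bochner_integrable a by exists 0.
  have am0 : bint unitI a = 0 by apply: bint_eq => //; exact: measurable_unitI.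
  have mJ := @measurable_dyadic R m k0.
  pose phi : R -> R := (fun=> 2 ^+ m : R) \_ (dyadic_itv m k0).
  have phi0 x : 0 <= phi x.
    by rewrite /phi patchE; case: ifP => // _; exact: exprn_ge0.
  have mphi : measurable_fun setT (phi : TR -> R).
    by apply/(measurable_restrictT _ mJ); exact: measurable_cst.
  have phi1 : (\int[mu]_(x in unitI) (phi x)%:E <= 1)%E.
    apply: (@le_trans _ _ (\int[mu]_x (phi x)%:E)%E).
      apply: ge0_subset_integral => //; first exact: measurable_unitI.
        exact/measurable_EFinP.
      by move=> x _; rewrite lee_fin.
    rewrite (_ : (\int[mu]_x _)%E = \int[mu]_(x in dyadic_itv m k0) (2 ^+ m)%:E)%E.
      apply: (@le_trans _ _ ((2 ^+ m)%:E * mu (dyadic_itv m k0))%E).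
        by rewrite -integral_cst.
      by rewrite mu_dyadic -EFinM mulfV ?expr2_neq0.
    rewrite [RHS]integral_mkcond; apply: eq_integral => x _.
    by rewrite /phi !patchE; case: ifP.
  have phiE x (t : R) : 0 <= t -> t <= ((fun=> (2 ^- m) `^ (- p^-1)) \_ (dyadic_itv m k0)) x ->
      t `^ p <= phi x.
    move=> t0; rewrite /phi !patchE; case: ifP => _ h.
      rewrite -atom_bound_pow; apply: ge0_ler_powR; rewrite ?nnegrE ?(ltW p0)//.
    have -> : t = 0 by apply/eqP; rewrite eq_le h t0.
    by rewrite powR0 ?gt_eqF.
  exists phi; split=> //.
  - exact: measurable_funTS.
  - by move=> n x Ix; apply: phiE => //; exact: dyadic_atom_avg.
  - split=> //; last by exists ((2 ^- m) `^ (- p^-1)) => //; exact: powR_ge0.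
    apply: le_trans phi1; apply: ae_ge0_le_integral => //.
    + exact: measurable_unitI.
    + exact: measurable_lp.
    + by move=> x _; rewrite lee_fin.
    + by apply/measurable_EFinP; exact: measurable_funTS.
    + apply: (ae_impl2 aM aM) => x ax _ Ix; rewrite lee_fin; apply: phiE => //.
      rewrite patchE; case: ifPn => [_|/negP nJ]; first exact: ax.
      by rewrite a0 ?normr0// => Jx; apply: nJ; exact: mem_set.
have ci : bochner_integrable (fun _ : R => v).
  by eexists; apply: bochner_cst => //; exact: measurable_unitI.
have av' : {in unitI, (fun=> v) =1 a} by move=> x /set_mem Ix; rewrite av.
have ai : bochner_integrable a by exact: bochner_integrable_eq av' ci.
have int1 : (\int[mu]_(x in unitI) (cst 1%:E x) <= 1)%E.
  apply: (@le_trans _ _ (1%:E * mu unitI)%E).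
    by rewrite -integral_cst//; exact: measurable_unitI.
  by rewrite mu_unitI mule1.
have v1p : `|v| `^ p <= 1.
  apply: (@le_trans _ _ (1 `^ p)); last by rewrite powR1.
  apply: ge0_ler_powR; rewrite ?nnegrE ?(ltW p0)//.
exists (cst 1); split=> //.
  move=> n x Ix; rewrite (@avg_cst_on _ _ a v)//; first exact: idx_lt.
  by move=> y Dy; apply: av; exact: dyadic_itv_sub (idx_lt n Ix) _ Dy.
split=> //; last by exists 1 => //; apply: aeW => x Ix; rewrite av.
apply: le_trans int1; have [_ [ma _]] := ai; apply: ge0_le_integral => //.
- exact: measurable_unitI.
- exact: measurable_lp.
- by move=> x Ix; rewrite lee_fin av.
Qed.

(** On an interval of length 2^-n the constant value is dominated by the majorant, whose integral is
    at most 1. The bound depends on n but not on the atom. *)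
Lemma atom_avg_le a n k : atoms p a -> (k < 2 ^ n)%N ->
  `|avg a n k| `^ p <= 2 ^+ n.
Proof.
move=> /atom_majorant[phi [mphi phi0 phi1 aphi _]] kn.
have DI := @dyadic_itv_sub R _ _ kn; have mD := @measurable_dyadic R n k.
have n0 : 0 < 2 ^+ n :> R by rewrite exprn_gt0.
rewrite -[leRHS]mul1r -ler_pdivrMr// -lee_fin; apply: le_trans phi1.
apply: (@le_trans _ _ (\int[mu]_(x in dyadic_itv n k) (phi x)%:E)%E); last first.
  apply: ge0_subset_integral => //; first exact: measurable_unitI.
    exact/measurable_EFinP.
  by move=> x _; rewrite lee_fin.
apply: (@le_trans _ _ (\int[mu]_(x in dyadic_itv n k) (cst (`|avg a n k| `^ p)%:E x))%E).
  by rewrite EFinM -(mu_dyadic n k) -integral_cst.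
apply: ge0_le_integral => //.
- by move=> x _; rewrite lee_fin powR_ge0.
- by apply/measurable_EFinP; apply: measurable_funS mphi => //; exact: measurable_unitI.
- by move=> x Dx; rewrite lee_fin -(dyadic_idx Dx); apply: aphi; exact: DI.
Qed.

End Atoms.

(** * Summation of an atomic expansion to a martingale *)

Section Synthesis.
Context {R : realType} {X : completeNormedModType R} (p : R).
Hypotheses (p0 : 0 < p) (p1 : p <= 1).
Local Notation mu := (@lebesgue_measure R).
Local Notation TR := (measurableTypeR R).
Variables (lambda : nat -> R) (a_ : nat -> R -> X).
Hypothesis aA : forall j, atoms p (a_ j).
Let L j : \bar R := (`|lambda j| `^ p)%:E.
Hypothesis lS : (\sum_(0 <= j <oo) L j < +oo)%E.

Let L0 j : (0 <= L j)%E. Proof. by rewrite lee_fin powR_ge0. Qed.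

Let psum N n k : X := \sum_(0 <= j < N) lambda j *: avg (a_ j) n k.

(** The sum of the martingales of the atoms is formed node by node in X. Convergence at a node is
    absolute: the p-th power of the sum of the norms is at most 2^n times the sum of the |lambda
    j|^p. *)
Let C n k : X := lim (psum N n k @[N --> \oo]).

Let psum_cvg n k : (k < 2 ^ n)%N -> psum N n k @[N --> \oo] --> C n k.
Proof.
move=> kn; suff : cvg (series (fun j => lambda j *: avg (a_ j) n k) @ \oo) by [].
apply: normed_cvg; apply: nondecreasing_is_cvgn.
  move=> i j ij; exact: (@nondecreasing_series R
    (fun j => `|lambda j *: avg (a_ j) n k|) xpredT 0 (fun _ _ _ => normr_ge0 _) i j ij).
pose S := fine (\sum_(0 <= j <oo) L j)%E.
exists ((S * 2 ^+ n) `^ p^-1) => _ [N _ <-] /=.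
rewrite /series/=; set s := \sum_(0 <= j < N) _; have s0 : 0 <= s by exact: sumr_ge0.
have -> : s = (s `^ p) `^ p^-1 by rewrite -powRrM mulfV ?gt_eqF// powRr1.
have S0 : 0 <= S by rewrite fine_ge0// nneseries_ge0.
apply: ge0_ler_powR; rewrite ?nnegrE ?invr_ge0 ?(ltW p0) ?powR_ge0 ?mulr_ge0 ?exprn_ge0//.
apply: le_trans (powR_sum p0 p1 _ _) _ => //.
apply: (@le_trans _ _ (\sum_(0 <= j < N) `|lambda j| `^ p * 2 ^+ n)).
  apply: ler_sum => j _; rewrite normrZ powRM// ler_wpM2l ?powR_ge0//.
  exact: atom_avg_le.
rewrite -mulr_suml ler_wpM2r ?exprn_ge0// -lee_fin fineK; last first.
  by rewrite ge0_fin_numE// nneseries_ge0.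
by rewrite -sumEFin; exact: nneseries_lim_ge.
Qed.

Let C_mean : mean_property C.
Proof.
move=> n k kn; have /andP[k1 k2] := child_lt kn.
have h : psum N n k @[N --> \oo] --> 2^-1 *: (C n.+1 k.*2 + C n.+1 k.*2.+1).
  rewrite (_ : (fun N => psum N n k) =
      (fun N => 2^-1 *: (psum N n.+1 k.*2 + psum N n.+1 k.*2.+1))).
    by apply: cvgZr; apply: cvgD; exact: psum_cvg.
  apply: funext => N; rewrite /psum -big_split/= scaler_sumr; apply: eq_bigr => j _.
  have [phi [_ _ _ _ [ai _ _]]] := atom_majorant p0 (aA j).
  rewrite (avg_mean ai kn); move: (avg _ n.+1 k.*2) (avg _ n.+1 k.*2.+1) => u v.
  by rewrite -scalerDr !scalerA mulrC.
exact: (cvg_unique (@norm_hausdorff _ _) (psum_cvg kn) h).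
Qed.

Let F n (x : R) := C n (idx n x).
Let G N n (x : R) := psum N n (idx n x).

Let phi j := sval (cid (atom_majorant p0 (aA j))).

Let phiP j : [/\ measurable_fun unitI (phi j : TR -> R), forall x, 0 <= phi j x,
      (\int[mu]_(x in unitI) (phi j x)%:E <= 1)%E,
      forall n x, unitI x -> `|avg (a_ j) n (idx n x)| `^ p <= phi j x
    & [/\ bochner_integrable (a_ j), (lp p (a_ j) <= 1)%E & ae_bounded (a_ j)]].
Proof. by rewrite /phi; case: cid. Qed.

Let term j x : \bar R := (L j * (phi j x)%:E)%E.

Let term0 j x : (0 <= term j x)%E.
Proof. by have [_ h _ _ _] := phiP j; rewrite mule_ge0// lee_fin. Qed.

(** Majorant at x, possibly +oo, of the p-th powers of the remainders after N terms at all levels n;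
    its integral is at most [tail N]. *)
Let T N x : \bar R := (\sum_(0 <= j <oo) term (j + N) x)%E.

Let tail N : \bar R := (\sum_(N <= j <oo) L j)%E.

Let T_int N : (\int[mu]_(x in unitI) T N x <= tail N)%E.
Proof.
have mphi j : measurable_fun unitI (fun x : TR => (phi j x)%:E).
  by have [h _ _ _ _] := phiP j; exact/measurable_EFinP.
rewrite integral_nneseries//.
- rewrite /tail -nneseries_addn//; apply: lee_nneseries => [j _ _|j _].
    by apply: integral_ge0.
  rewrite /term; have [_ h h1 _ _] := phiP (j + N).
  rewrite ge0_integralZl//.
  + by rewrite -[leRHS]mule1 lee_wpmul2l.
  + exact: measurable_unitI.
  + exact: mphi.
  + by move=> x _; rewrite lee_fin.
- exact: measurable_unitI.
- by move=> j; apply: measurable_funeM; exact: mphi.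
Qed.

Let T_meas N : measurable_fun unitI (T N : TR -> \bar R).
Proof.
apply: (ge0_emeasurable_sum (P := xpredT)) => // j _.
have [h _ _ _ _] := phiP (j + N).
by apply: measurable_funeM; exact/measurable_EFinP.
Qed.

Let psum_diff N M n x : unitI x -> (N <= M)%N ->
  ((`|psum M n (idx n x) - psum N n (idx n x)| `^ p)%:E <= T N x)%E.
Proof.
move=> Ix NM.
have -> : psum M n (idx n x) - psum N n (idx n x) =
    \sum_(N <= j < M) lambda j *: avg (a_ j) n (idx n x).
  by rewrite /psum (@big_cat_nat _ _ _ N 0 M)//= addrAC subrr add0r.
apply: (@le_trans _ _ (\sum_(N <= j < M) term j x)%E); last first.
  by rewrite /T (nneseries_addn (f := term^~ x))//; exact: nneseries_lim_ge.
apply: (@le_trans _ _ ((\sum_(N <= j < M) `|lambda j *: avg (a_ j) n (idx n x)|) `^ p)%:E).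
  rewrite lee_fin; apply: ge0_ler_powR; rewrite ?nnegrE ?(ltW p0) ?sumr_ge0//.
  exact: ler_norm_sum.
apply: (@le_trans _ _ (\sum_(N <= j < M) `|lambda j *: avg (a_ j) n (idx n x)| `^ p)%:E).
  by rewrite lee_fin; exact: powR_sum.
rewrite -sumEFin; apply: lee_sum => j _; rewrite /term -EFinM lee_fin normrZ powRM//.
by rewrite ler_wpM2l ?powR_ge0//; have [_ _ _ h _] := phiP j; exact: h.
Qed.

Let FG_diff N n x : unitI x -> ((`|F n x - G N n x| `^ p)%:E <= T N x)%E.
Proof.
move=> Ix; have h := psum_cvg (idx_lt n Ix).
have : (0 <= T N x)%E by apply: nneseries_ge0.
case ET : (T N x) => [t| |]//; last by move=> _; rewrite leey.
rewrite !lee_fin => t0.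
have tE : t = (t `^ p^-1) `^ p by rewrite -powRrM mulVf ?gt_eqF// powRr1.
rewrite [leRHS]tE; apply: ge0_ler_powR; rewrite ?nnegrE ?(ltW p0) ?powR_ge0//.
apply/ler_addgt0Pr => e e0.
move/cvgrPdist_lt/(_ _ e0) : h => h.
have [M [NM hM]] := filter_ex (filterI (nbhs_infty_ge N) h).
rewrite [leRHS]addrC; apply: le_trans (ler_distD (psum M n (idx n x)) _ _) _.
apply: lerD; first exact: ltW.
have := @psum_diff N M n x Ix NM; rewrite ET lee_fin [leRHS]tE => h'.
rewrite leNgt; apply/negP => lt; move: h'; rewrite leNgt => /negP; apply.
by apply: gt0_ltr_powR; rewrite ?nnegrE ?powR_ge0.
Qed.

Let F_meas n : strongly_measurable (F n).
Proof. exact: (@step_strongly_measurable _ _ n (C n)). Qed.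

Let G_meas N n : strongly_measurable (G N n).
Proof. exact: (@step_strongly_measurable _ _ n (psum N n)). Qed.

Let hp_FG N : (hp p (fun n x => (F n x - G N n x)%R) <= tail N)%E.
Proof.
apply: le_trans (T_int N); apply: hp_le => //.
- by move=> n; exact: strongly_measurableB.
- by move=> x; apply: nneseries_ge0.
- by move=> n x Ix; exact: FG_diff.
Qed.

Let hp_F : (hp p F <= \sum_(0 <= j <oo) L j)%E.
Proof.
apply: le_trans (hp_FG 0); rewrite le_eqVlt; apply/orP; left; apply/eqP.
by apply: hp_eq => n x _; rewrite /G /psum big_nil subr0.
Qed.

Let F_mart : dyadic_martingale F.
Proof. by apply/dyadic_martingaleP; exists C. Qed.

Let S N (x : R) := \sum_(j < N) lambda j *: a_ j x.

Let ai j : bochner_integrable (a_ j). Proof. by have [_ _ _ _ []] := phiP j. Qed.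

Let S_int N : bochner_integrable (S N).
Proof. exact: bochner_integrable_sum. Qed.

Let GE N n x : unitI x -> G N n x = avg (S N) n (idx n x).
Proof.
move=> Ix; rewrite /G /psum /S avg_sum//; last exact: idx_lt.
by rewrite big_mkord.
Qed.

Let tail_lty N : (tail N < +oo)%E.
Proof.
apply: le_lt_trans lS; rewrite [leRHS](nneseries_split 0 N)//.
by rewrite add0n leeDr// sume_ge0.
Qed.

Let Hm_F : Hm p F.
Proof. by split=> //; rewrite Hm_normE// root_lty//; exact: le_lt_trans lS. Qed.

Let S_L1 N : L1_martingale (G N).
Proof.
exists (S N); last first.
  by move=> n; apply/cond_expP; split=> // x Ix; rewrite GE.
have [_ [mS _]] := S_int N; split=> //.
rewrite Lp_normE// root_lty// /lp.
under eq_integral do rewrite powRr1//.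
exact: bochner_integrable_norm.
Qed.

Let Hm_G N : Hm p (G N).
Proof.
have [f _ fG] := S_L1 N; split.
  apply/dyadic_martingaleP; exists (avg (S N)); first exact: avg_mean.
  by move=> n x Ix; rewrite GE.
rewrite Hm_normE// root_lty//; apply: le_lt_trans (tail_lty 0).
apply: le_trans (T_int 0); apply: hp_le => //.
  by move=> x; apply: nneseries_ge0.
move=> n x Ix; have := psum_diff n Ix (leq0n N).
by rewrite /psum [X in _ - X]big_nil subr0.
Qed.

Let tail_cvg (e : R) : 0 < e -> \forall N \near \oo, (tail N < e%:E)%E.
Proof.
move=> e0; have /cvge0P h := @nneseries_tail_cvg R L xpredT lS (fun k _ => L0 k).
by apply: h => // N; exact: nneseries_ge0.
Qed.

Let Hm_ring_F : Hm_ring p F.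
Proof.
split=> // e e0; have e0' : 0 < e `^ p by rewrite powR_gt0.
have [N hN] := filter_ex (tail_cvg e0').
exists (G N); split=> //; rewrite Hm_normE// root_lt ?hp_ge0 ?lee_fin ?(ltW e0)//.
by rewrite poweR_EFin; apply: le_lt_trans (hp_FG N) hN.
Qed.

Let S_bdd N : ae_bounded (S N).
Proof.
rewrite /S; elim: N => [|N IH].
  by exists 0 => //; apply: aeW => x _; rewrite big_ord0 normr0.
have [M M0 h] : ae_bounded (fun x => lambda N *: a_ N x + \sum_(j < N) lambda j *: a_ j x).
  by apply: ae_bounded_lin => //; have [_ _ _ _ []] := phiP N.
exists M => //; apply: (ae_impl2 h h) => x + _ Ix.
by rewrite big_ord_recr/= addrC; exact.
Qed.

Variable f : R -> X.
Hypothesis mf : strongly_measurable f.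
Hypothesis Sf : Lp_cvg p%:E (fun n x => \sum_(j < n) lambda j *: a_ j x) f.

Let F_cvg : Lp_cvg p%:E F f.
Proof.
apply/(Lp_cvgP p0) => e e0; have e30 : 0 < e / 3 by rewrite divr_gt0.
move/(Lp_cvgP p0)/(_ _ e30) : Sf => hS.
have [N [hN1 hN2]] := filter_ex (filterI hS (tail_cvg e30)).
have [M M0 SM] := S_bdd N.
have [_ [mS _]] := S_int N.
have := avg_cvg_lp p0 M0 (S_int N) SM e30; apply: filterS => n hn.
(* Three errors: the tail of the expansion at the level of martingales, the averages of the partial
   sum S N, and S N against f. N is fixed before n, because the averages of S N approach S N only
   for given N. *)
rewrite (@lp_eq _ _ _ _ (fun x => (F n x - G N n x) + ((G N n x - S N x) + (S N x - f x)))); last first.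
  by move=> x _; rewrite addrA !subrKA.
have m1 : strongly_measurable (fun x => F n x - G N n x) by exact: strongly_measurableB.
have m2 : strongly_measurable (fun x => G N n x - S N x) by exact: strongly_measurableB.
have m3 : strongly_measurable (fun x => S N x - f x) by exact: strongly_measurableB.
have m4 : strongly_measurable (fun x => (G N n x - S N x) + (S N x - f x)).
  by apply: strongly_measurable_eq (strongly_measurable_lin 1 m2 m3) => x _; rewrite scale1r.
apply: le_lt_trans (lp_triangle p0 p1 m1 m4) _.
have -> : e = e / 3 + (e / 3 + e / 3) by lra.
rewrite EFinD; apply: lteD.
  apply: le_lt_trans hN2; apply: le_trans (hp_FG N).
  have mFG k : strongly_measurable (fun x => F k x - G N k x).
    exact: strongly_measurableB.
  exact: (lp_le_hp p0 n mFG).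
apply: le_lt_trans (lp_triangle p0 p1 m2 m3) _; rewrite EFinD.
apply: lteD; last exact: hN1.
by rewrite (@lp_eq _ _ p _ (fun x => avg (S N) n (idx n x) - S N x)) // => x /set_mem Ix; rewrite GE.
Qed.

Lemma synthesis : exists F, [/\ Hm_ring p F, Lp_cvg p%:E F f
  & (hp p F <= \sum_(0 <= j <oo) (`|lambda j| `^ p)%:E)%E].
Proof. by exists F. Qed.

End Synthesis.

(** * From martingales to atoms *)

Section Decomposition.
Context {R : realType} {X : completeNormedModType R} (p : R).
Hypothesis p0 : 0 < p.
Local Notation mu := (@lebesgue_measure R).
Local Notation TR := (measurableTypeR R).
Variable c : nat -> nat -> X.
Hypothesis cm : mean_property c.

(* [cost] bounds from below the integral of max(t, 2 F^* )^p over an interval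
   ([cost_integral]); its recursive form is the one that the induction of
   [decompose] consumes. *)
Fixpoint cost N n k (t : R) : R :=
  if N is N'.+1 then
    cost N' n.+1 k.*2 (Num.max t (2 * `|c n.+1 k.*2|))
    + cost N' n.+1 k.*2.+1 (Num.max t (2 * `|c n.+1 k.*2.+1|))
  else 2 ^- n * t `^ p.

Lemma powR_max_sub (s t u : R) : 0 <= t -> t <= u ->
  Num.max u s `^ p - Num.max t s `^ p <= u `^ p - t `^ p /\
  0 <= Num.max u s `^ p - Num.max t s `^ p.
Proof.
move=> t0 tu; have mon x y : 0 <= x -> x <= y -> x `^ p <= y `^ p.
  move=> x0 xy; apply: ge0_ler_powR; rewrite ?nnegrE ?(ltW p0)//.
  exact: le_trans xy.
have htu := mon t u t0 tu.
case: (leP u s) => us; case: (leP t s) => ts.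
- by rewrite subrr subr_ge0 lexx.
- by lra.
- have h1 := mon t s t0 ts; have h2 := mon s u (le_trans t0 ts) (ltW us); lra.
- by rewrite lexx subr_ge0.
Qed.

Lemma expr2V n : 2 ^- n = 2 ^- n.+1 + 2 ^- n.+1 :> R.
Proof. by rewrite exprS invfM; lra. Qed.

Lemma expr2V_gt0 n : 0 < 2 ^- n :> R.
Proof. by rewrite invr_gt0 exprn_gt0. Qed.

(** Unfolded, the cost is a sum over leaves of the length of the leaf times the p-th power of the
    maximum of t and a number independent of t. As a function of t^p it is nondecreasing, with slope
    at most the total length 2^-n. *)
Lemma cost_lip N n k t u : 0 <= t -> t <= u ->
  cost N n k t <= cost N n k u /\
  cost N n k u - cost N n k t <= 2 ^- n * (u `^ p - t `^ p).
Proof.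
elim: N n k t u => [|N IH] n k t u t0 tu /=.
  rewrite mulrBr lexx; split=> //; rewrite ler_wpM2l ?(ltW (expr2V_gt0 n))//.
  by apply: ge0_ler_powR; rewrite ?nnegrE ?(ltW p0)// (le_trans t0).
set v0 := 2 * `|c _ k.*2|; set v1 := 2 * `|c _ k.*2.+1|.
have mx (s : R) : 0 <= Num.max t s by rewrite le_max t0.
have my (s : R) : Num.max t s <= Num.max u s.
  by rewrite ge_max !le_max tu lexx orbT.
have [h1 h2] := IH n.+1 k.*2 _ _ (mx v0) (my v0).
have [h3 h4] := IH n.+1 k.*2.+1 _ _ (mx v1) (my v1).
have [g1 _] := powR_max_sub v0 t0 tu; have [g2 _] := powR_max_sub v1 t0 tu.
have e0 := ltW (expr2V_gt0 n.+1).
have := ler_wpM2l e0 g1; have := ler_wpM2l e0 g2.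
by rewrite [2 ^- n]expr2V => f1 f2; split; lra.
Qed.

(** On a child, replacing t by its maximum with twice the norm of c leaves the integrand unchanged,
    because h dominates that norm there. This is the recursion of [cost]. *)
Lemma cost_integral (h : R -> \bar R) N n k t :
  measurable_fun unitI (h : TR -> \bar R) -> (forall x, 0 <= h x)%E ->
  (forall m x, unitI x -> ((`|c m (idx m x)|)%:E <= h x)%E) ->
  (k < 2 ^ n)%N -> 0 <= t ->
  ((cost N n k t)%:E <=
   \int[mu]_(x in dyadic_itv n k) (maxe t%:E (2%:E * h x) `^ p))%E.
Proof.
move=> mh h0 ch; have mg u : measurable_fun unitI
    (fun x : TR => (maxe u%:E (2%:E * h x) `^ p)%E).
  apply: (measurableT_comp (@measurable_poweR R p)).
  by apply: measurable_maxe => //; apply: measurable_funeM.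
elim: N n k t => [|N IH] n k t kn t0 /=.
  apply: (@le_trans _ _ (\int[mu]_(x in dyadic_itv n k) (cst (t `^ p)%:E x))%E).
    by rewrite mulrC EFinM -(mu_dyadic n k) -integral_cst//; exact: measurable_dyadic.
  apply: ge0_le_integral => //; try exact: measurable_dyadic.
  - by move=> x _; rewrite lee_fin powR_ge0.
  - by apply: measurable_funS (mg t) => //; [exact: measurable_unitI|exact: dyadic_itv_sub].
  - by move=> x _; rewrite -poweR_EFin lee_poweR2// ?le_max ?lee_fin ?t0// lexx.
have /andP[k1 k2] := child_lt kn.
rewrite [in leRHS]dyadic_itvU ge0_integral_setU//; try exact: measurable_dyadic.
- have key j : (j < 2 ^ n.+1)%N ->
      (\int[mu]_(x in dyadic_itv n.+1 j) (maxe t%:E (2%:E * h x) `^ p) =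
       \int[mu]_(x in dyadic_itv n.+1 j)
         (maxe (Num.max t (2 * `|c n.+1 j|))%:E (2%:E * h x) `^ p))%E.
    move=> jn; apply: eq_integral => x /set_mem Dx; congr poweR.
    have e : ((2 * `|c n.+1 j|)%:E <= 2%:E * h x)%E.
      rewrite EFinM lee_wpmul2l// -(dyadic_idx Dx); apply: ch.
      exact: dyadic_itv_sub Dx.
    by rewrite EFin_max -maxA (max_r e).
  rewrite EFinD !key//; apply: leeD; apply: IH => //; by rewrite le_max t0.
- by rewrite -dyadic_itvU; apply: measurable_funS (mg t) => //;
    [exact: measurable_unitI|exact: dyadic_itv_sub].
- by move=> x _; exact: poweR_ge0.
- by apply: dyadic_disj; rewrite neq_ltn ltnSn.
Qed.

Definition ind n k (v : X) : R -> X := fun x => if x \in dyadic_itv n k then v else 0.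

Lemma bochner_ind n k v : (k < 2 ^ n)%N ->
  is_bochner_integral unitI (ind n k v) (2 ^- n *: v).
Proof.
move=> kn; have mI := @measurable_unitI R.
have si : simple_fun (ind n k v).
  exact: (simple_map_comp (fun b : bool => if b then v else 0)
    (simple_map_mem (measurable_dyadic n k))).
have ii : bochner_integrable (ind n k v).
  by eexists; apply: bochner_simple.
have := bintP mI (@subset_refl _ _) ii; congr is_bochner_integral.
rewrite -(@bint_off_zero _ _ n k)//; last first.
  by move=> x _ nD; rewrite /ind ifF//; apply/negbTE/negP => /set_mem.
rewrite (@bint_cst_on _ _ _ _ v)// ?mu_dyadic//.
- exact: measurable_dyadic.
- exact: dyadic_itv_sub.
- by move=> x xD; rewrite /ind xD.
Qed.

Lemma Lp_norm_oo_ge (a : R -> X) (M : R) : 0 <= M ->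
  (forall x, unitI x -> `|a x| <= M) -> (Lp_norm +oo%E a <= M%:E)%E.
Proof.
move=> M0 aM; rewrite /Lp_norm unlock; case: ifP => _; last by rewrite lee_fin.
apply/ess_supP; apply: aeW => x /=; rewrite patchE; case: ifPn => [/set_mem Ix|_].
  by rewrite /= normr_id lee_fin aM.
by rewrite (_ : point = 0%E)// abse0 lee_fin.
Qed.

(** An emitted atom of height 2 u on J has mass 2^p u^p |J|. It is paid from half of |J| (u^p -
    t^p), and u >= 2 t gives u^p - t^p >= (1 - 2^-p) u^p; the quotient is [Kdec]. *)
Definition Kdec : R := 2 * 2 `^ p / (1 - 2 `^ (- p)).

Let q_lt1 : 0 < 1 - 2 `^ (- p) :> R.
Proof.
rewrite subr_gt0 powRN invf_lt1 ?powR_gt0//; apply: (@le_lt_trans _ _ (1 `^ p)).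
  by rewrite powR1.
by apply: gt0_ltr_powR; rewrite ?nnegrE// ltr1n.
Qed.

Lemma K_ge0 : 0 <= Kdec.
Proof. by rewrite divr_ge0 ?(ltW q_lt1)// mulr_ge0 ?powR_ge0. Qed.

Lemma jump_cost t u : 0 <= t -> 2 * t <= u ->
  2 `^ p * u `^ p <= Kdec * (u `^ p - t `^ p) / 2.
Proof.
move=> t0 tu; have u0 : 0 <= u by apply: le_trans tu; rewrite mulr_ge0.
have h : t `^ p <= 2 `^ (- p) * u `^ p.
  rewrite powRN ler_pdivlMl ?powR_gt0// -powRM//.
  by apply: ge0_ler_powR; rewrite ?nnegrE ?(ltW p0)// mulr_ge0.
have -> : 2 `^ p * u `^ p = Kdec * ((1 - 2 `^ (- p)) * u `^ p) / 2.
  by rewrite /Kdec; field; rewrite gt_eqF.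
rewrite ler_wpM2r ?invr_ge0//; apply: ler_wpM2l; first exact: K_ge0.
by rewrite mulrBl mul1r; lra.
Qed.

(* The remainder b is what has not been emitted yet below the interval; the
   caller either carries it on or normalizes it into an atom. *)
Lemma decompose N n k t : (k < 2 ^ n)%N -> 0 < t -> `|c n k| <= t ->
  exists (b : R -> X) (s : seq (R * (R -> X))),
  [/\ [/\ is_bochner_integral unitI b 0,
          forall x, unitI x -> ~ dyadic_itv n k x -> b x = 0
        & forall x, dyadic_itv n k x -> `|c n k + b x| <= t],
      all (fun l => `[< dyadic_atom p l.2 >]) s,
      forall x, unitI x -> \sum_(l <- s) l.1 *: l.2 x =
        if x \in dyadic_itv n k then c (n + N) (idx (n + N) x) - c n k - b x else 0
    & \sum_(l <- s) `|l.1| `^ p <= Kdec * (cost N n k t - 2 ^- n * t `^ p)].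
Proof.
elim: N n k t => [|N IH] n k t kn t0 ct.
  exists (fun=> 0), [::]; split=> //; first split=> //.
  - have := bochner_cst (0 : X) (@measurable_unitI R) (@subset_refl _ _).
    by rewrite scaler0.
  - by move=> x _; rewrite addr0.
  - move=> x Ix; rewrite big_nil; case: ifP => // /set_mem Dx.
    by rewrite addn0 (dyadic_idx Dx) subrr subr0.
  - by rewrite big_nil /= subrr mulr0.
have /andP[k0n k1n] := child_lt kn.
have vE := cm kn; set v := c n k in vE ct *.
set v0 := c n.+1 k.*2 in vE *; set v1 := c n.+1 k.*2.+1 in vE *.
(* Both children are run with a common threshold u. On each child the new remainder is the increment
   v0 - v or v1 - v plus the remainder of that child; the increments cancel in mean because v is the
   mean of v0 and v1. *)
have combine u : 0 < u -> `|v0| <= u -> `|v1| <= u ->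
  exists (b : R -> X) (s : seq (R * (R -> X))),
  [/\ [/\ is_bochner_integral unitI b 0,
          forall x, unitI x -> ~ dyadic_itv n k x -> b x = 0
        & forall x, dyadic_itv n k x -> `|v + b x| <= u],
      all (fun l => `[< dyadic_atom p l.2 >]) s,
      forall x, unitI x -> \sum_(l <- s) l.1 *: l.2 x =
        if x \in dyadic_itv n k then c (n + N.+1) (idx (n + N.+1) x) - v - b x else 0
    & \sum_(l <- s) `|l.1| `^ p <= Kdec * (cost N n.+1 k.*2 u + cost N n.+1 k.*2.+1 u
        - 2 ^- n * u `^ p)].
  move=> u0 v0u v1u.
  have [b0 [s0 [[ib0 zb0 nb0] as0 ss0 cs0]]] := IH _ _ _ k0n u0 v0u.
  have [b1 [s1 [[ib1 zb1 nb1] as1 ss1 cs1]]] := IH _ _ _ k1n u0 v1u.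
  have dis (x : R) : dyadic_itv n.+1 k.*2 x -> dyadic_itv n.+1 k.*2.+1 x -> False.
    move=> /dyadic_idx h1 /dyadic_idx; rewrite h1 => h2.
    by have := ltnSn k.*2; rewrite -{2}h2 ltnn.
  exists (fun x => 1 *: (1 *: ind n.+1 k.*2 (v0 - v) x + ind n.+1 k.*2.+1 (v1 - v) x)
    + (1 *: b0 x + b1 x)), (s0 ++ s1).
  split; first split.
  - have -> : 0 = 1 *: (1 *: (2 ^- n.+1 *: (v0 - v)) + 2 ^- n.+1 *: (v1 - v)) + (1 *: 0 + 0) :> X.
      rewrite scaler0 !addr0 !scale1r -scalerDr addrACA -opprD.
      rewrite vE -scalerDl (_ : 2^-1 + 2^-1 = 1 :> R); last by lra.
      by rewrite scale1r subrr scaler0.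
    have mI := @measurable_unitI R.
    by apply: bochner_lin => //; apply: bochner_lin => //; exact: bochner_ind.
  - move=> x Ix nD; rewrite !scale1r /ind !ifF ?addr0 ?zb0 ?zb1 ?addr0//.
    + by move=> h; apply: nD; rewrite dyadic_itvU; right.
    + by move=> h; apply: nD; rewrite dyadic_itvU; left.
    + by apply/negbTE/negP => /set_mem h; apply: nD; rewrite dyadic_itvU; right.
    + by apply/negbTE/negP => /set_mem h; apply: nD; rewrite dyadic_itvU; left.
  - move=> x Dx; have Ix : unitI x by exact: dyadic_itv_sub Dx.
    move: Dx; rewrite dyadic_itvU !scale1r /ind => -[D0|D1].
      rewrite mem_set// ifF; last by apply/negbTE/negP => /set_mem; exact: dis.
      rewrite zb1 ?addr0//; last exact: dis.
      by rewrite addrA (addrC v) subrK; exact: nb0.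
    rewrite ifF; last by apply/negbTE/negP => /set_mem h; exact: (dis x).
    rewrite mem_set// zb0 ?add0r//; last by move=> h; exact: (dis x).
    by rewrite addrA (addrC v) subrK; exact: nb1.
  - by rewrite all_cat as0 as1.
  - move=> x Ix; rewrite big_cat/= ss0// ss1// addSnnS !scale1r /ind.
    have [/set_mem D0|nD0] := boolP (x \in dyadic_itv n.+1 k.*2).
      have nD1 : x \in dyadic_itv n.+1 k.*2.+1 = false.
        by apply/negbTE/negP => /set_mem; exact: dis.
      rewrite nD1 mem_set; last by rewrite dyadic_itvU; left.
      rewrite zb1//; last exact: dis.
      by rewrite !addr0 -/v0 [in RHS]opprD opprB !addrA subrK.
    have [/set_mem D1|nD1] := boolP (x \in dyadic_itv n.+1 k.*2.+1).
      rewrite mem_set; last by rewrite dyadic_itvU; right.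
      rewrite zb0//; last by move=> h; exact: (dis x).
      by rewrite !add0r -/v1 [in RHS]opprD opprB !addrA subrK.
    rewrite addr0 ifF//; apply/negbTE/negP => /set_mem; rewrite dyadic_itvU => -[] /mem_set h.
      by rewrite h in nD0.
    by rewrite h in nD1.
  - rewrite big_cat/=; apply: le_trans (lerD cs0 cs1) _.
    by rewrite -mulrDr [2 ^- n]expr2V le_eqVlt; apply/orP; left; apply/eqP; congr (_ * _); lra.
have zero_int := bochner_cst (0 : X) (@measurable_unitI R) (@subset_refl _ _).
rewrite scaler0 in zero_int.
(* Without a jump nothing is emitted and the remainder is handed to the caller; the cost only grows,
   being monotone in the threshold. *)
have [/andP[v0t v1t]|m_gt] := boolP ((`|v0| <= t) && (`|v1| <= t)).
  have [b [s [hb hs hsum hc]]] := combine t t0 v0t v1t.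
  exists b, s; split=> //; apply: le_trans hc _; apply: ler_wpM2l; first exact: K_ge0.
  rewrite /= lerD2r; apply: lerD;
    by apply: (cost_lip _ _ _ (ltW t0) _).1; rewrite le_max lexx.
have tm : t < Num.max `|v0| `|v1|.
  by rewrite lt_max !ltNge -negb_and.
(* The new threshold dominates both children and at least doubles t. As t < m, also u <= 2 m; so the
   threshold max(t, 2 m) that [cost] gives to the larger child is at least u, which is the purpose
   of the factor 2 in [cost]. *)
set m := Num.max `|v0| `|v1| in tm; pose u := Num.max (2 * t) m.
have tu2 : 2 * t <= u by rewrite le_max lexx.
have tu : t <= u by apply: le_trans tu2; lra.
have mlu : m <= u by rewrite le_max lexx orbT.
have u2m : u <= 2 * m by rewrite ge_max; apply/andP; split; lra.
have u0 : 0 < u by apply: lt_le_trans tu.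
have v0u : `|v0| <= u by apply: le_trans mlu; rewrite le_max lexx.
have v1u : `|v1| <= u by apply: le_trans mlu; rewrite le_max lexx orbT.
have [b [s [[ib zb nb] as_ hsum hc]]] := combine u u0 v0u v1u.
(* On J the norm of b is at most u + t <= 2 u, from the bounds on v + b and on v. Division by lam =
   2 u |J|^(1/p) brings it to the height |J|^(-1/p) of an atom. *)
pose r : R := (2 ^- n) `^ p^-1.
have r0 : 0 < r by rewrite powR_gt0// expr2V_gt0.
pose lam := 2 * u * r.
have lam0 : 0 < lam by rewrite mulr_gt0// mulr_gt0.
have rp : r `^ p = 2 ^- n.
  by rewrite /r -powRrM mulVf ?gt_eqF// powRr1// ltW// expr2V_gt0.
have lamp : `|lam| `^ p = 2 ^- n * (2 `^ p * u `^ p).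
  rewrite gtr0_norm// /lam powRM ?rp ?(ltW r0) ?mulr_ge0 ?(ltW u0)//.
  by rewrite powRM ?(ltW u0)// mulrC.
(* The whole remainder goes into the atom. What is left is 0, for which the hypothesis on c n k
   restores the threshold t of the caller. *)
exists (fun=> 0), ((lam, fun x => lam^-1 *: b x) :: s); split.
- by split=> // x _; rewrite addr0.
- rewrite /= as_ andbT; apply/asboolP; exists n, (dyadic_itv n k).
  have iab : is_bochner_integral unitI (fun x => lam^-1 *: b x) 0.
    have := bochner_lin lam^-1 (@measurable_unitI R) (@subset_refl _ _) ib zero_int.
    rewrite scaler0 addr0; apply: bochner_eq => //.
    by move=> x _; rewrite addr0.
  split; [by exists k|split=> //].
  + by case: iab.
  + by move=> x Ix nD; rewrite zb// scaler0.
  + apply: Lp_norm_oo_ge; first exact: powR_ge0.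
    move=> x Ix; rewrite normrZ gtr0_norm ?invr_gt0//.
    rewrite powRN -/r ler_pdivrMl// /lam mulfK ?gt_eqF//.
    have [Dx|nD] := pselect (dyadic_itv n k x); last first.
      by rewrite zb// normr0 mulr_ge0// ltW.
    have -> : b x = (v + b x) - v by rewrite addrAC subrr add0r.
    by apply: le_trans (ler_normB _ _) _; have := nb x Dx; lra.
- move=> x Ix; rewrite big_cons/= hsum// scalerA mulfV ?gt_eqF// scale1r.
  case: ifPn => [_|nD]; first by rewrite subr0 addrC subrK.
  by rewrite addr0 zb// => /mem_set; apply/negP.
- rewrite big_cons lamp.
  set C0 := cost N n.+1 k.*2 in hc *; set C1 := cost N n.+1 k.*2.+1 in hc *.
  have L0 := @cost_lip N n.+1 k.*2; have L1 := @cost_lip N n.+1 k.*2.+1.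
  have t0' := ltW t0; have u0' := ltW u0.
  have mx (w : R) : t <= Num.max t w by rewrite le_max lexx.
  (* For the child attaining m, the cost at u is at most the cost at max(t, 2 m). For the other one,
     passing from u down to t loses at most 2^-(n+1) (u^p - t^p). So half of 2^-n (u^p - t^p) is
     left to pay for the atom. *)
  have key : C0 u + C1 u - 2 ^- n * u `^ p + 2 ^- n * (u `^ p - t `^ p) / 2 <=
      cost N.+1 n k t - 2 ^- n * t `^ p.
    rewrite /= -/C0 -/C1 -/v0 -/v1 expr2V.
    have [f0 g0] := L0 t u t0' tu; have [f1 g1] := L1 t u t0' tu.
    have h0 := (L0 _ _ t0' (mx (2 * `|v0|))).1.
    have h1 := (L1 _ _ t0' (mx (2 * `|v1|))).1.
    move: f0 g0 f1 g1 h0 h1; rewrite -/C0 -/C1 => f0 g0 f1 g1 h0 h1.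
    have [m0|m1] : m = `|v0| \/ m = `|v1|.
      by rewrite /m; case: leP => _; [right|left].
    + have := (L0 u (Num.max t (2 * `|v0|)) u0' _).1; rewrite -/C0 => hh.
      have {}hh : C0 u <= C0 (Num.max t (2 * `|v0|)).
        by apply: hh; rewrite le_max -m0 u2m orbT.
      lra.
    + have := (L1 u (Num.max t (2 * `|v1|)) u0' _).1; rewrite -/C1 => hh.
      have {}hh : C1 u <= C1 (Num.max t (2 * `|v1|)).
        by apply: hh; rewrite le_max -m1 u2m orbT.
      lra.
  have jc := ler_wpM2l (ltW (expr2V_gt0 n)) (jump_cost t0' tu2).
  apply: le_trans (ler_wpM2l K_ge0 key).
  apply: le_trans (lerD jc hc) _.
  by rewrite le_eqVlt; apply/orP; left; apply/eqP; ring.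
Qed.

End Decomposition.

(** * Decomposition of a martingale up to a finite level *)

Section StepMartingales.
Context {R : realType} {X : completeNormedModType R} (p : R).
Hypotheses (p0 : 0 < p) (p1 : p <= 1).
Local Notation mu := (@lebesgue_measure R).
Local Notation TR := (measurableTypeR R).
Implicit Types (c : nat -> nat -> X) (f : R -> X).

(** The summands pay for the constant part with coefficient t, for the last remainder as an atom on
    [unitI] with coefficient 2 t, and for the atoms emitted inside the tree. *)
Definition Kstep : R := 1 + 2 `^ p + Kdec p * 2 `^ p.

Lemma Kstep_ge1 : 1 <= Kstep.
Proof.
by rewrite /Kstep -addrA lerDl addr_ge0 ?powR_ge0// mulr_ge0 ?powR_ge0//; exact: K_ge0.
Qed.

Lemma avg_coarse c N n k : mean_property c -> (n <= N)%N -> (k < 2 ^ n)%N ->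
  avg (fun x => c N (idx N x)) n k = c n k.
Proof.
move=> cm nN; rewrite -(subKn nN); move: (N - n)%N (leq_subr n N) => d.
elim: d k => [k _ kn|d IH k dN kn].
  by move: kn; rewrite subn0 => kn; rewrite (avg_step (c N)).
have e : (N - d = (N - d.+1).+1)%N by rewrite subnSK.
have /andP[k1 k2] := child_lt kn.
rewrite (avg_mean (step_integrable N (c N)) kn) -e !IH ?(ltnW dN) ?e//.
by rewrite -cm.
Qed.

(** A martingale stopped at level N is the one generated by its N-th term. *)
Lemma truncated_avg c N n (x : R) : mean_property c -> unitI x ->
  avg (fun y => c N (idx N y)) n (idx n x) = c (minn n N) (idx (minn n N) x).
Proof.
move=> cm Ix; have [nN|Nn] := leqP n N; first by rewrite avg_coarse// idx_lt.
apply: avg_cst_on; [exact: step_integrable|exact: idx_lt|].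
move=> y Dy; congr (c N _); apply: (idx_coarse (ltnW Nn)) => //.
  exact: dyadic_itv_sub (idx_lt n Ix) _ Dy.
exact: dyadic_idx.
Qed.

(** [decompose] is run from the root with threshold t. A positive bound t stands in for the
    quasi-norm so that it can be divided by. *)
Lemma step_decomposition c N t : mean_property c -> 0 < t ->
  (hp p (fun n x => c n (idx n x)) <= (t `^ p)%:E)%E ->
  exists s : seq (R * (R -> X)), [/\ all (fun l => `[< atoms p l.2 >]) s,
    forall x, unitI x -> \sum_(l <- s) l.1 *: l.2 x = c N (idx N x)
  & \sum_(l <- s) `|l.1| `^ p <= Kstep * t `^ p].
Proof.
move=> cm t0; set F := fun n x => _; move=> hF.
have mF n : strongly_measurable (F n) by exact: (@step_strongly_measurable _ _ n (c n)).
have ct : `|c 0%N 0%N| <= t.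
  rewrite leNgt; apply/negP => tc.
  have : ((`|c 0%N 0%N| `^ p)%:E <= (t `^ p)%:E)%E.
    apply: le_trans hF; apply: le_trans (lp_le_hp p0 0%N mF).
    rewrite (_ : lp p (F 0%N) = \int[mu]_(x in unitI) (cst (`|c 0%N 0%N| `^ p)%:E x))%E.
      apply: (@le_trans _ _ ((`|c 0%N 0%N| `^ p)%:E * mu unitI)%E).
        by rewrite mu_unitI mule1.
      by rewrite -integral_cst//; exact: measurable_unitI.
    by apply: eq_integral => x /set_mem Ix; rewrite /F idx0.
  rewrite lee_fin leNgt => /negP; apply; apply: gt0_ltr_powR; rewrite ?nnegrE ?(ltW t0)//.
have [b [s [[ib zb nb] sA ss sc]]] := @decompose _ _ p p0 c cm N 0%N 0%N t isT t0 ct.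
have mI := @measurable_unitI R.
have zero_int := bochner_cst (0 : X) mI (@subset_refl _ _).
rewrite scaler0 in zero_int.
(* The p-th power of max(t, 2 h), for h the maximal function, is at most t^p + 2^p h^p, and [unitI]
   has measure 1. *)
have costE : cost p c N 0 0 t <= t `^ p + 2 `^ p * t `^ p.
  rewrite -lee_fin; apply: le_trans (cost_integral p0 N (h := maximal_fun F)  _ _ _ _ (ltW t0)) _ => //.
  - exact: measurable_maximal.
  - by move=> x; exact: maximal_ge0.
  - by move=> m x _; exact: (maximal_ge F).
  rewrite dyadic_itv00.
  apply: (@le_trans _ _ (\int[mu]_(x in unitI) (cst (t `^ p)%:E x +
      (2 `^ p)%:E * maximal_fun F x `^ p))%E).
    apply: ge0_le_integral => //.
    + by move=> x _; exact: poweR_ge0.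
    + apply: (measurableT_comp (@measurable_poweR R p)).
      apply: measurable_maxe => //; apply: measurable_funeM.
      exact: measurable_maximal.
    + apply: emeasurable_funD => //; apply: measurable_funeM; exact: measurable_hp.
    + move=> x _; rewrite -!poweR_EFin -poweRM ?maximal_ge0//.
      rewrite /maxe; case: ifP => _.
        by rewrite leeDr// poweR_ge0.
      by rewrite leeDl// poweR_ge0.
  rewrite ge0_integralD//; first last.
  - by apply: measurable_funeM; exact: measurable_hp.
  - by move=> x _; rewrite mule_ge0 ?poweR_ge0// lee_fin powR_ge0.
  - by move=> x _; rewrite lee_fin powR_ge0.
  rewrite EFinD; apply: leeD.
    apply: (@le_trans _ _ ((t `^ p)%:E * mu unitI)%E); last by rewrite mu_unitI mule1.
    by rewrite -integral_cst.
  rewrite ge0_integralZl ?lee_fin ?powR_ge0//.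
  - by rewrite EFinM; apply: lee_wpmul2l => //; rewrite lee_fin powR_ge0.
  - exact: measurable_hp.
  - by move=> x _; exact: poweR_ge0.
exists [:: (t, fun=> t^-1 *: c 0%N 0%N), (2 * t, fun x => (2 * t)^-1 *: b x) & s].
have t20 : 0 < 2 * t by rewrite mulr_gt0.
split.
- rewrite /=; apply/and3P; split.
  + apply/asboolP; right; exists (t^-1 *: c 0%N 0%N) => //.
    by rewrite normrZ gtr0_norm ?invr_gt0// ler_pdivrMl// mulr1.
  + apply/asboolP; left; exists 0%N, unitI.
    have iab : is_bochner_integral unitI (fun x => (2 * t)^-1 *: b x) 0.
      have := bochner_lin (2 * t)^-1 mI (@subset_refl _ _) ib zero_int.
      rewrite scaler0 addr0; apply: bochner_eq => //.
      by move=> x _; rewrite addr0.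
    split; first by exists 0%N => //; exact: dyadic_itv00.
    split=> //; first by case: iab.
    rewrite expr0 invr1 powR1; apply: Lp_norm_oo_ge => // x Ix.
    rewrite normrZ gtr0_norm ?invr_gt0// ler_pdivrMl// mulr1.
    have -> : b x = (c 0%N 0%N + b x) - c 0%N 0%N by rewrite addrAC subrr add0r.
    apply: le_trans (ler_normB _ _) _.
    have := nb x; rewrite dyadic_itv00 => /(_ Ix); lra.
  + by apply: sub_all sA => l /asboolP h; apply/asboolP; left.
- move=> x Ix; rewrite !big_cons/= ss// add0n dyadic_itv00 mem_set//.
  rewrite !scalerA !mulfV ?gt_eqF// !scale1r.
  by rewrite [b x + _]addrC subrK addrC subrK.
- rewrite !big_cons/= !gtr0_norm// powRM ?(ltW t0)//.
  have K0 : 0 <= Kdec p by exact: K_ge0.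
  have h : Kdec p * (cost p c N 0 0 t - t `^ p) <= Kdec p * (2 `^ p * t `^ p).
    by rewrite ler_wpM2l//; lra.
  move: sc; rewrite expr0 invr1 mul1r => sc.
  apply: (@le_trans _ _ (t `^ p + (2 `^ p * t `^ p + Kdec p * (2 `^ p * t `^ p)))).
    by rewrite !lerD2l; exact: le_trans h.
  by rewrite /Kstep le_eqVlt; apply/orP; left; apply/eqP; ring.
Qed.

End StepMartingales.

(** * Concatenation of finite blocks into one sequence *)

Section Concatenation.
Context {T : Type} (d : T) (L : nat -> seq T).
Hypothesis L_neq0 : forall i, (0 < size (L i))%N.

Let blocks m := flatten (mkseq L m).

(** Expansions are indexed by [nat], whereas decompositions come as lists. Nonempty lists guarantee
    that the first j + 1 of them have more than j entries together, so the default d is never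
    read. *)
Definition concat j : T := nth d (blocks j.+1) j.

Let blocksD m e : exists w, blocks (m + e) = blocks m ++ w.
Proof.
exists (flatten [seq L i | i <- iota m e]).
by rewrite /blocks /mkseq iotaD add0n map_cat flatten_cat.
Qed.

Lemma size_blocks m : (m <= size (blocks m))%N.
Proof.
elim: m => // m IH; rewrite /blocks mkseqS flatten_rcons size_cat.
by rewrite -addn1 leq_add// L_neq0.
Qed.

Let concatE m j : (j < size (blocks m))%N -> concat j = nth d (blocks m) j.
Proof.
move=> jm; rewrite /concat; have [mj|jm'] := leqP m j.+1.
  have [w] := blocksD m (j.+1 - m); rewrite subnKC// => ->.
  by rewrite nth_cat jm.
have [w] := blocksD j.+1 (m - j.+1); rewrite subnKC ?(ltnW jm')// => ->.
by rewrite nth_cat size_blocks.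
Qed.

Lemma concat_sum (V : nmodType) (phi : T -> V) m :
  \sum_(0 <= j < size (blocks m)) phi (concat j) =
  \sum_(0 <= i < m) \sum_(l <- L i) phi l.
Proof.
transitivity (\sum_(l <- blocks m) phi l).
  rewrite [RHS](big_nth d) !big_nat; apply: eq_bigr => j /andP[_ jm].
  by rewrite (concatE jm).
by rewrite /blocks big_flatten/= /mkseq big_map /index_iota subn0.
Qed.

Lemma concat_all (P : pred T) : (forall i, all P (L i)) -> forall j, P (concat j).
Proof.
move=> LP j; have : all P (blocks j.+1).
  elim: j.+1 => // m IH; rewrite /blocks mkseqS flatten_rcons all_cat LP andbT.
  exact: IH.
move=> /(all_nthP d) h.
exact: h (size_blocks j.+1).
Qed.

End Concatenation.

(** * Atomic expansion of the elements of the closure *)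

Section Analysis.
Context {R : realType} {X : completeNormedModType R} (p : R).
Hypotheses (p0 : 0 < p) (p1 : p <= 1).
Local Notation mu := (@lebesgue_measure R).
Local Notation TR := (measurableTypeR R).
Implicit Types (c : nat -> nat -> X) (f : R -> X) (F : nat -> R -> X).

Lemma lp_scale (r : R) f : strongly_measurable f ->
  lp p (fun x : R => r *: f x) = ((`|r| `^ p)%:E * lp p f)%E.
Proof.
move=> mf; rewrite /lp -ge0_integralZl//.
- by apply: eq_integral => x _; rewrite normrZ powRM// EFinM.
- exact: measurable_unitI.
- exact: measurable_lp.
Qed.

Lemma hp_distC F (G : nat -> R -> X) :
  hp p (fun n (x : R) => F n x - G n x) = hp p (fun n (x : R) => G n x - F n x).
Proof.
apply: eq_integral => x _; congr poweR; congr ereal_sup.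
by apply/seteqP; split=> _ [n _ <-]; exists n => //; rewrite distrC.
Qed.

Lemma martingale_measurable F n : dyadic_martingale F -> strongly_measurable (F n).
Proof.
move=> /dyadic_martingaleP[c _ FE].
exact: (@step_strongly_measurable _ _ n (c n) _ (FE n)).
Qed.

Lemma lp_atom_sum (lambda : nat -> R) (a_ : nat -> R -> X) (r : seq nat) :
  (forall j, atoms p (a_ j)) ->
  strongly_measurable (fun x : R => \sum_(j <- r) lambda j *: a_ j x) /\
  (lp p (fun x : R => \sum_(j <- r) lambda j *: a_ j x)%R <=
   \sum_(j <- r) (`|lambda j| `^ p)%:E)%E.
Proof.
move=> aA; have ha j : strongly_measurable (a_ j) /\ (lp p (a_ j) <= 1)%E.
  by have [_ [_ _ _ _ [[_ [ma _]] a1 _]]] := atom_majorant p0 (aA j).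
elim: r => [|j r [IHm IH]].
  split.
    apply: (@strongly_measurable_eq _ _ (fun=> 0)) => [x _|].
      by rewrite big_nil.
    exact: simple_strongly_measurable (simple_fun_cst _).
  rewrite big_nil /lp; under eq_integral do rewrite big_nil normr0 powR0 ?gt_eqF//.
  by rewrite integral0.
have [mj lj] := ha j.
have mjr : strongly_measurable (fun x : R => lambda j *: a_ j x).
  apply: (@strongly_measurable_eq _ _ (fun x : R => lambda j *: a_ j x + (fun=> 0) x)).
    by move=> x _; rewrite addr0.
  by apply: strongly_measurable_lin => //; exact: simple_strongly_measurable (simple_fun_cst _).
split.
  apply: strongly_measurable_eq (strongly_measurable_lin (lambda j) mj IHm) => x _.
  by rewrite big_cons.
rewrite big_cons (@lp_eq _ _ p _ (fun x : R => lambda j *: a_ j x + \sum_(j <- r) lambda j *: a_ j x)).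
  apply: le_trans (lp_triangle p0 p1 mjr IHm) _; apply: leeD => //.
  by rewrite lp_scale// -[leRHS]mule1 lee_wpmul2l// lee_fin powR_ge0.
by move=> x _; rewrite big_cons.
Qed.

(** Half of the error is spent on a nearby G in L_1, half on stopping G. The second component of y
    is the level from which the tree is constant. *)
Lemma step_approximation F (e : R) : Hm_ring p F -> 0 < e ->
  exists y : (nat -> nat -> X) * nat, [/\ mean_property y.1,
    forall n (x : R), unitI x -> (y.2 <= n)%N -> y.1 n (idx n x) = y.1 y.2 (idx y.2 x)
  & (hp p (fun n (x : R) => F n x - y.1 n (idx n x))%R < e%:E)%E].
Proof.
move=> [[Fmart _] HF] e0; have e20 : 0 < e / 2 by rewrite divr_gt0.
have e2' : 0 < (e / 2) `^ p^-1 by rewrite powR_gt0.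
have [G [[Gmart hG] [g _ gG] FG]] := HF _ e2'.
have [gi _] := (cond_expP _ _ _).1 (gG 0%N).
have GE n (x : R) : unitI x -> G n x = avg g n (idx n x).
  by have [_ h] := (cond_expP _ _ _).1 (gG n); exact: h.
rewrite Hm_normE// root_lty// in hG.
move: FG; rewrite Hm_normE// root_lt ?hp_ge0 ?lee_fin ?powR_ge0// poweR_EFin.
rewrite -powRrM mulVf ?gt_eqF// powRr1 ?(ltW e20)// => FG.
have [N hN] := truncation_cvg p0 gi GE hG e20.
pose c := avg (fun y : R => avg g N (idx N y)).
have cE n (x : R) : unitI x -> c n (idx n x) = G (minn n N) x.
  by move=> Ix; rewrite /c truncated_avg// ?GE//; exact: avg_mean.
exists (c, N); split => /=.
- by apply: avg_mean; exact: step_integrable.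
- by move=> n x Ix Nn; rewrite !cE// minnn (minn_idPr Nn).
have mF n := martingale_measurable n Fmart.
have mG n := martingale_measurable n Gmart.
rewrite (splitr e) EFinD.
apply: le_lt_trans (lteD FG hN).
rewrite (@hp_eq _ _ p _ (fun n (x : R) => (F n x - G n x) + (G n x - G (minn n N) x))).
  by apply: hp_triangle => // n; exact: strongly_measurableB.
by move=> n x /set_mem Ix; rewrite cE// addrA subrK.
Qed.

Lemma geometric_sum_le m : \sum_(0 <= i < m) 2 ^- i <= 2 - 2 * 2 ^- m :> R.
Proof.
elim: m => [|m IH]; first by rewrite big_nil expr0 invr1; lra.
rewrite big_nat_recr//=; have := @expr2V R m; lra.
Qed.

(** Approximants with errors T 2^-i have successive differences of mass at most 2 T 2^-i, to which
    [step_decomposition] applies. Summing the geometric series contributes another factor 2, hence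
    4. *)
Lemma analysis F f (T : R) : Hm_ring p F -> strongly_measurable f ->
  Lp_cvg p%:E F f -> (hp p F < T%:E)%E ->
  exists lambda a_, atomic_expansion p f lambda a_ /\
    (\sum_(0 <= j <oo) (`|lambda j| `^ p)%:E <= (4 * Kstep p * T)%:E)%E.
Proof.
move=> HF mf Ff FT.
have T0 : 0 < T by rewrite -lte_fin; apply: le_lt_trans FT; exact: hp_ge0.
have Fmart := HF.1.1; have mF n := martingale_measurable n Fmart.
pose e i := T * 2 ^- i.
have e0 i : 0 < e i by rewrite mulr_gt0// expr2V_gt0.
have /choice[y yP] : forall i, exists y : (nat -> nat -> X) * nat,
    [/\ mean_property y.1,
    forall n (x : R), unitI x -> (y.2 <= n)%N -> y.1 n (idx n x) = y.1 y.2 (idx y.2 x),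
    (hp p (fun n (x : R) => F n x - y.1 n (idx n x))%R < (e i)%:E)%E
  & i = 0%N -> forall n k, y.1 n k = 0].
  move=> [|i]; last first.
    by have [y [h1 h2 h3]] := step_approximation HF (e0 i.+1); exists y.
  (* The approximant of index 0 is the zero martingale, admissible since e 0 = T exceeds hp p F; the
     telescoping sum then has no initial term. *)
  exists (fun _ _ => 0, 0%N); split=> //=.
    by move=> n k _; rewrite addr0 scaler0.
  rewrite (@hp_eq _ _ p _ F) => [|n x _]; last by rewrite subr0.
  by rewrite /e expr0 invr1 mulr1.
pose h i (x : R) := (y i).1 (y i).2 (idx (y i).2 x).
have mc i n : strongly_measurable (fun x : R => (y i).1 n (idx n x)).
  exact: (@step_strongly_measurable _ _ n ((y i).1 n)).
have mFc i n : strongly_measurable (fun x : R => F n x - (y i).1 n (idx n x)).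
  exact: strongly_measurableB.
pose D i n k := (y i.+1).1 n k - (y i).1 n k.
have D_mean i : mean_property (D i).
  have [m1 _ _ _] := yP i; have [m2 _ _ _] := yP i.+1.
  by move=> n k kn; rewrite /D m1// m2// -scalerBr opprD addrACA.
pose t i := (2 * e i) `^ p^-1.
have t0 i : 0 < t i by rewrite powR_gt0// mulr_gt0.
have tp i : t i `^ p = 2 * e i.
  by rewrite /t -powRrM mulVf ?gt_eqF// powRr1// mulr_ge0// ltW.
have D_hp i : (hp p (fun n (x : R) => D i n (idx n x)) <= (t i `^ p)%:E)%E.
  rewrite (@hp_eq _ _ p _ (fun n (x : R) => ((y i.+1).1 n (idx n x) - F n x) +
      (F n x - (y i).1 n (idx n x)))); last by move=> n x _; rewrite addrA subrK.
  apply: le_trans (hp_triangle p0 p1 _ _) _ => //.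
    by move=> n; exact: strongly_measurableB.
  have [_ _ h1 _] := yP i; have [_ _ h2 _] := yP i.+1.
  rewrite hp_distC tp; apply: (@le_trans _ _ ((e i.+1)%:E + (e i)%:E)%E).
    by apply: leeD; exact: ltW.
  rewrite -EFinD lee_fin /e [2 ^- i]expr2V.
  by have := mulr_gt0 T0 (@expr2V_gt0 R i.+1); lra.
pose M i := maxn (y i).2 (y i.+1).2.
have /choice[s sP] : forall i, exists s : seq (R * (R -> X)),
    [/\ all (fun l => `[< atoms p l.2 >]) s,
    forall x, unitI x -> \sum_(l <- s) l.1 *: l.2 x = D i (M i) (idx (M i) x)
  & \sum_(l <- s) `|l.1| `^ p <= Kstep p * t i `^ p].
  by move=> i; exact: (step_decomposition p0 (M i) (D_mean i) (t0 i) (D_hp i)).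
have DM i (x : R) : unitI x -> D i (M i) (idx (M i) x) = h i.+1 x - h i x.
  have [_ h1 _ _] := yP i; have [_ h2 _ _] := yP i.+1.
  by move=> Ix; rewrite /D /h h1 ?h2// /M ?leq_maxl ?leq_maxr.
(* A zero term in front keeps every block nonempty, as the concatenation requires; the zero function
   belongs to [atoms] as a constant. *)
pose z : R * (R -> X) := (0, fun=> 0).
pose L i := z :: s i.
have Ls i : (0 < size (L i))%N by [].
pose lam j := (concat z L j).1; pose a_ j := (concat z L j).2.
have aA j : atoms p (a_ j).
  apply/asboolP; apply: (@concat_all _ z L Ls (fun l => `[< atoms p l.2 >])) => i /=.
  have [-> _ _] := sP i; rewrite andbT; apply/asboolP; right.
  by exists 0 => //; rewrite normr0.
pose La j : \bar R := (`|lam j| `^ p)%:E.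
have La0 j : (0 <= La j)%E by rewrite lee_fin powR_ge0.
pose nb m := size (flatten (mkseq L m)).
have nb_ge m : (m <= nb m)%N by exact: size_blocks.
have K0 : 0 <= Kstep p by exact: le_trans ler01 (Kstep_ge1 p0).
have costL m : \sum_(0 <= j < nb m) `|lam j| `^ p <= 4 * Kstep p * T.
  rewrite (concat_sum z Ls (fun l : R * (R -> X) => `|l.1| `^ p)).
  apply: (@le_trans _ _ (\sum_(0 <= i < m) (Kstep p * 2 * T) * 2 ^- i)).
    apply: ler_sum => i _; rewrite big_cons/= normr0 powR0 ?gt_eqF// add0r.
    have [_ _ h1] := sP i; apply: le_trans h1 _.
    by rewrite tp /e; rewrite !mulrA.
  rewrite -mulr_sumr.
  have -> : 4 * Kstep p * T = (Kstep p * 2 * T) * 2 by ring.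
  apply: ler_wpM2l; first by rewrite !mulr_ge0// ltW.
  by apply: le_trans (geometric_sum_le m) _; have := @expr2V_gt0 R m; lra.
have LaS : (\sum_(0 <= j <oo) La j <= (4 * Kstep p * T)%:E)%E.
  apply: lime_le; first exact: is_cvg_nneseries.
  apply: nearW => n; apply: (@le_trans _ _ (\sum_(0 <= j < nb n) La j)%E).
    by apply: lee_sum_nneg_natr => //; exact: nb_ge.
  by rewrite sumEFin lee_fin.
have LaT : (\sum_(0 <= j <oo) La j < +oo)%E by apply: le_lt_trans LaS _; rewrite ltry.
exists lam, a_; split; last exact: LaS.
split=> //; apply/(Lp_cvgP p0) => r r0.
have r20 : 0 < r / 2 by rewrite divr_gt0.
have r40 : 0 < r / 4 by rewrite divr_gt0.
have tail : \forall n \near \oo, (\sum_(n <= j <oo) La j < (r / 2)%:E)%E.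
  have /cvge0P H := @nneseries_tail_cvg R La xpredT LaT (fun k _ => La0 k).
  by apply: H => // n; exact: nneseries_ge0.
have small : \forall m \near \oo, e m < r / 4.
  have d0 : 0 < r / 4 / T by rewrite divr_gt0.
  have := near_infty_natSinv_expn_lt (PosNum d0); apply: filterS => m /=.
  by rewrite /e div1r ltr_pdivlMr// mulrC.
case: tail => M0 _ tail.
have [m [M0m em]] := filter_ex (filterI (nbhs_infty_ge M0) small).
have {tail} tailm : (\sum_(nb m <= j <oo) La j < (r / 2)%:E)%E.
  by apply: tail => /=; exact: leq_trans M0m (nb_ge m).
have hm (x : R) : unitI x -> \sum_(0 <= j < nb m) lam j *: a_ j x = h m x.
  move=> Ix; rewrite (concat_sum z Ls (fun l : R * (R -> X) => l.1 *: l.2 x)).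
  transitivity (\sum_(0 <= i < m) (h i.+1 x - h i x)).
    apply: eq_bigr => i _; rewrite big_cons/= scaler0 add0r -DM//.
    by have [_ h1 _] := sP i; exact: h1.
  rewrite telescope_sumr//; have [_ _ _ /(_ erefl) z0] := yP 0%N.
  by rewrite [h 0%N x]z0 subr0.
have mh : strongly_measurable (h m) by exact: mc.
have hmf : (lp p (fun x : R => h m x - f x)%R < (r / 2)%:E)%E.
  have /(Lp_cvgP p0)/(_ _ r40) Ff' := Ff.
  (* From level (y m).2 on, the approximant has the fixed value h m, so h m is compared with f
     through F n for one large n. *)
  have [n [mn Fn]] := filter_ex (filterI (nbhs_infty_ge (y m).2) Ff').
  rewrite (@lp_eq _ _ p _ (fun x : R => (h m x - F n x) + (F n x - f x))); last first.
    by move=> x _; rewrite addrA subrK.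
  have ma : strongly_measurable (fun x : R => h m x - F n x) by exact: strongly_measurableB.
  have mb : strongly_measurable (fun x : R => F n x - f x) by exact: strongly_measurableB.
  apply: le_lt_trans (lp_triangle p0 p1 ma mb) _.
  have -> : r / 2 = r / 4 + r / 4 by lra.
  rewrite EFinD; apply: lteD; last exact: Fn.
  apply: (@lt_trans _ _ (e m)%:E); last by rewrite lte_fin.
  have [_ stab hc _] := yP m; apply: le_lt_trans hc.
  rewrite lp_distC (@lp_eq _ _ p _ (fun x : R => F n x - (y m).1 n (idx n x))); last first.
    by move=> x /set_mem Ix; rewrite stab.
  exact: (lp_le_hp p0 (F := fun n (x : R) => F n x - (y m).1 n (idx n x)) n (mFc m)).
exists (nb m) => // n /= mn.
(* The partial sum at the block boundary nb m is exactly h m; the further terms have p-mass at most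
   the tail of the coefficients, so partial sums inside a block converge as well. *)
rewrite (@lp_eq _ _ p _ (fun x : R => \sum_(j <- index_iota (nb m) n) lam j *: a_ j x +
    (h m x - f x))); last first.
  move=> x /set_mem Ix; rewrite -hm// addrA; congr (_ - _).
  by rewrite -(big_mkord xpredT (fun j => lam j *: a_ j x)) (@big_cat_nat _ _ _ (nb m) 0 n)//= addrC.
have [mS lS] := lp_atom_sum lam (index_iota (nb m) n) aA.
have mhf : strongly_measurable (fun x : R => h m x - f x) by exact: strongly_measurableB.
apply: le_lt_trans (lp_triangle p0 p1 mS mhf) _.
rewrite (splitr r) EFinD; apply: lteD; last exact: hmf.
by apply: le_lt_trans lS _; apply: le_lt_trans tailm; exact: nneseries_lim_ge.
Qed.

End Analysis.

(** * Comparison of the quasi-norms *)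

Section Comparison.
Context {R : realType} {X : completeNormedModType R} (p : R).
Hypotheses (p0 : 0 < p) (p1 : p <= 1).
Implicit Types (f : R -> X) (F : nat -> R -> X).

Lemma Ha_norm_ge0 f : (0 <= Ha_norm p f)%E.
Proof. by apply: le_ereal_inf_tmp => _ [la _ <-]; exact: poweR_ge0. Qed.

Lemma Ha_norm_le_Hm_norm F f : Hm_ring p F -> strongly_measurable f ->
  Lp_cvg p%:E F f ->
  (Ha_norm p f <= ((4 * Kstep p) `^ p^-1)%:E * Hm_norm p F)%E.
Proof.
move=> HF mf Ff; have [[_ hF] _] := HF.
rewrite Hm_normE// root_lty// in hF.
have K1 := Kstep_ge1 p0; have K0 : 0 < 4 * Kstep p by lra.
rewrite Hm_normE// -poweR_EFin -poweRM ?hp_ge0 ?lee_fin ?(ltW K0)//.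
rewrite root_ge ?Ha_norm_ge0//; last by rewrite mule_ge0 ?hp_ge0// lee_fin ltW.
have /fineK hE : hp p F \is a fin_num by rewrite ge0_fin_numE// hp_ge0.
(* [analysis] asks for a strict bound T on hp p F; the slack e / (4 Kstep) becomes e after
   multiplication by 4 Kstep. *)
apply/lee_addgt0Pr => e e0; pose T := fine (hp p F) + e / (4 * Kstep p).
have FT : (hp p F < T%:E)%E by rewrite -hE lte_fin ltrDl divr_gt0.
have [lam [a_ [la laS]]] := analysis p0 p1 HF mf Ff FT.
have -> : ((4 * Kstep p)%:E * hp p F + e%:E = (4 * Kstep p * T)%:E)%E.
  rewrite -[in LHS]hE -EFinM -EFinD /T; congr (_%:E).
  by move: (4 * Kstep p) K0 => k k0; field; rewrite gt_eqF.
apply: le_trans laS; rewrite -[leRHS](poweR_invK p0); last first.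
  by apply: nneseries_ge0 => j _ _; rewrite lee_fin powR_ge0.
rewrite lee_poweR2 ?Ha_norm_ge0 ?poweR_ge0//.
by apply: ereal_inf_lbound; exists (lam, a_).
Qed.

End Comparison.

Theorem theorem3p3 (R : realType) (X : completeNormedModType R) (p : R)
    (p_gt0 : 0 < p) (p_le1 : p <= 1) :
  @Hm_ring_fun R X p = @Ha R X p /\
  exists2 C : R, 0 < C & forall f : R -> X, Ha p f ->
    (Hm_ring_fun_norm p f <= C%:E * Ha_norm p f)%E /\
    (Ha_norm p f <= C%:E * Hm_ring_fun_norm p f)%E.
Proof.
have K1 : 1 <= 4 * Kstep p by have := Kstep_ge1 p_gt0; lra.
split.
  apply/seteqP; split=> f.
    move=> [Lf [F HF Ff]]; have [[_ hF] _] := HF.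
    rewrite Hm_normE// root_lty// in hF.
    have /fineK hE : hp p F \is a fin_num by rewrite ge0_fin_numE// hp_ge0.
    have FT : (hp p F < (fine (hp p F) + 1)%:E)%E by rewrite -[ltLHS]hE lte_fin ltrDl.
    have [lam [a_ [la _]]] := analysis p_gt0 p_le1 HF Lf.1 Ff FT.
    by split=> //; exists lam, a_.
  move=> [Lf [lam [a_ [aA lS Sf]]]].
  have [F [HF Ff _]] := synthesis p_gt0 p_le1 aA lS Lf.1 Sf.
  by split=> //; exists F.
exists ((4 * Kstep p) `^ p^-1); first by rewrite powR_gt0//; lra.
(* Summation of an expansion has constant 1, so with C >= 1 the constant of the decomposition serves
   both inequalities. *)
have C1 : 1 <= (4 * Kstep p) `^ p^-1.
  apply: (@le_trans _ _ (1 `^ p^-1)); first by rewrite powR1.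
  by apply: ge0_ler_powR; rewrite ?nnegrE ?invr_ge0 ?(ltW p_gt0)//; lra.
have C0 : 0 < (4 * Kstep p) `^ p^-1 by exact: lt_le_trans C1.
move=> f [[mf _] _]; split.
  apply: (@le_trans _ _ (Ha_norm p f)); last first.
    by apply: lee_pemull; rewrite ?Ha_norm_ge0 ?lee_fin.
  (* Each expansion of f yields its own martingale with limit f; the infimum in [Hm_ring_fun_norm]
     is below the quasi-norm of every one of them. *)
  apply: le_ereal_inf_tmp => _ [[lam a_] /= [aA lS Sf] <-].
  have [F [HF Ff FS]] := synthesis p_gt0 p_le1 aA lS mf Sf.
  apply: (@le_trans _ _ (Hm_norm p F)); first by apply: ereal_inf_lbound; exists F.
  rewrite Hm_normE//; have S0 := le_trans (hp_ge0 p F) FS.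
  by rewrite root_ge ?poweR_ge0 ?poweR_invK ?hp_ge0.
rewrite -lee_pdivrMl//; apply: le_ereal_inf_tmp => _ [F [HF Ff] <-].
by rewrite lee_pdivrMl//; exact: Ha_norm_le_Hm_norm.
Qed.
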